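(* Let $f$ be a regular function (not necessarily slice preserving) in a neighborhood of $\overline{\mathbb{B}}$ with $f(\mathbb{B})\subseteq\mathbb{B}$, such that $f(0)\neq0$ and every zero of $f$ lies in $$C=\{\alpha+I\beta\in\mathbb{H}:\ \beta\geq|\alpha|,\ \beta\neq0,\ I\in\mathbb{S}\}.$$ If $|f^{s}(0)|\exp\left(\frac{1}{8}\Delta\log|f^{s}(x)|_{|x=0}\right)\leq1$, then $f$ has no zeros in $\mathbb{B}_{r}$ for every $r>0$ such that $$r<\sqrt{|f^{s}(0)|}\,\exp\left(\frac{1}{16}\Delta\log|f^{s}(x)|_{|x=0}\right).$$
   Context: $\mathbb{H}$ denotes the quaternions, identified with $\mathbb{R}^4$, $x^c$ the usual conjugate, $|x|^2=xx^c$, $\mathbb{B}_r=\{|x|<r\}$, $\mathbb{B}=\mathbb{B}_1$, $\Delta$ the Laplacian of $\mathbb{R}^4$, $\mathbb{S}=\{I\in\mathbb{H}:I^2=-1\}$. Let $\mathbb{H}_{\mathbb{C}}=\mathbb{H}\otimes_{\mathbb{R}}\mathbb{C}=\{p+\imath q\}$ with product $(p_1+\imath q_1)(p_2+\imath q_2)=p_1p_2-q_1q_2+\imath(p_1q_2+q_1p_2)$ and $\overline{p+\imath q}=p-\imath q$. For an open $D\subseteq\mathbb{C}$ symmetric under conjugation, $\Omega_D=\{\alpha+I\beta:\alpha+i\beta\in D,I\in\mathbb{S}\}$. A stem function is $F=F_1+\imath F_2:D\to\mathbb{H}_{\mathbb{C}}$ with $F(\bar z)=\overline{F(z)}$; it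 induces the slice function $f=\mathcal{I}(F):\Omega_D\to\mathbb{H}$, $f(\alpha+I\beta)=F_1(\alpha+i\beta)+IF_2(\alpha+i\beta)$; $f$ is regular if $F$ is $C^1$ with $\partial F/\partial\alpha+\imath\,\partial F/\partial\beta=0$. The symmetrization of $f$ is $f^s=\mathcal{I}(F^cF)$, where $F^c=F_1^c+\imath F_2^c$. *)

(* Defs.v *)
(* World: Stdlib reals + Coquelicot. *)
From Stdlib Require Import Reals Lra.
From Coquelicot Require Import Coquelicot.
Open Scope R_scope.

(* The quaternion x0 + x1 i + x2 j + x3 k.  As an iterated product it inherits
   the product topology and normed module structure of R^4. *)
Definition quat : Type := (R * R * R * R)%type.

Definition mkq (a b c d : R) : quat := (a, b, c, d).
Definition q0 (x : quat) : R := fst (fst (fst x)).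
Definition q1 (x : quat) : R := snd (fst (fst x)).
Definition q2 (x : quat) : R := snd (fst x).
Definition q3 (x : quat) : R := snd x.

Definition qreal (a : R) : quat := mkq a 0 0 0.
Definition qadd (x y : quat) : quat :=
  mkq (q0 x + q0 y) (q1 x + q1 y) (q2 x + q2 y) (q3 x + q3 y).
Definition qopp (x : quat) : quat := mkq (- q0 x) (- q1 x) (- q2 x) (- q3 x).
Definition qsub (x y : quat) : quat := qadd x (qopp y).
Definition qmul (x y : quat) : quat :=
  mkq (q0 x * q0 y - q1 x * q1 y - q2 x * q2 y - q3 x * q3 y)
      (q0 x * q1 y + q1 x * q0 y + q2 x * q3 y - q3 x * q2 y)
      (q0 x * q2 y - q1 x * q3 y + q2 x * q0 y + q3 x * q1 y)
      (q0 x * q3 y + q1 x * q2 y - q2 x * q1 y + q3 x * q0 y).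
Definition qconj (x : quat) : quat := mkq (q0 x) (- q1 x) (- q2 x) (- q3 x).
(* |x|^2 = x x^c, see qmul_conj below. *)
Definition qabs (x : quat) : R :=
  sqrt (q0 x ^ 2 + q1 x ^ 2 + q2 x ^ 2 + q3 x ^ 2).

Definition im_sphere (I : quat) : Prop := qmul I I = qreal (-1).

(* a + I b *)
Definition qslice (a : R) (I : quat) (b : R) : quat :=
  qadd (qreal a) (qmul I (qreal b)).

(* The pair (p, q) stands for p + \imath q in H (x) C. *)
Definition quatC : Type := (quat * quat)%type.
Definition qCadd (u v : quatC) : quatC :=
  (qadd (fst u) (fst v), qadd (snd u) (snd v)).
Definition qCmul (u v : quatC) : quatC :=
  (qsub (qmul (fst u) (fst v)) (qmul (snd u) (snd v)),
   qadd (qmul (fst u) (snd v)) (qmul (snd u) (fst v))).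
Definition qCbar (u : quatC) : quatC := (fst u, qopp (snd u)).
Definition qCc (u : quatC) : quatC := (qconj (fst u), qconj (snd u)).
Definition qC0 : quatC := (qreal 0, qreal 0).
Definition qCi : quatC := (qreal 0, qreal 1).

(* Functions on a domain are total functions whose values matter only there. *)
Definition conj_symmetric (D : C -> Prop) : Prop :=
  forall z : C, D z -> D (Cconj z).

Definition Omega (D : C -> Prop) (x : quat) : Prop :=
  exists (a b : R) (I : quat), D (a, b) /\ im_sphere I /\ x = qslice a I b.

Definition stem (D : C -> Prop) (F : C -> quatC) : Prop :=
  forall z : C, D z -> F (Cconj z) = qCbar (F z).

Definition induces (D : C -> Prop) (F : C -> quatC) (f : quat -> quat) : Prop :=
  forall (a b : R) (I : quat), D (a, b) -> im_sphere I ->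
    f (qslice a I b) = qadd (fst (F (a, b))) (qmul I (snd (F (a, b)))).

(* C^1 on D together with dF/da + \imath dF/db = 0;
   Fa and Fb are the two partial derivatives. *)
Definition stem_holomorphic (D : C -> Prop) (F : C -> quatC) : Prop :=
  exists Fa Fb : C -> quatC, forall z : C, D z ->
    is_derive (fun a : R => F (a, Im z)) (Re z) (Fa z) /\
    is_derive (fun b : R => F (Re z, b)) (Im z) (Fb z) /\
    continuous Fa z /\ continuous Fb z /\
    qCadd (Fa z) (qCmul qCi (Fb z)) = qC0.

Definition slice_regular (D : C -> Prop) (F : C -> quatC) (f : quat -> quat)
  : Prop :=
  stem D F /\ stem_holomorphic D F /\ induces D F f.

Definition sym_stem (F : C -> quatC) (z : C) : quatC := qCmul (qCc (F z)) (F z).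

Definition qim (x : quat) : quat := mkq 0 (q1 x) (q2 x) (q3 x).

(* Im x / |Im x|, and the arbitrary value i at real points. *)
Definition im_unit (x : quat) : quat :=
  if Req_EM_T (qabs (qim x)) 0 then mkq 0 1 0 0
  else qmul (qim x) (qreal (/ qabs (qim x))).

(* The slice function I(F), evaluated through the representation
   x = Re x + im_unit x * |Im x|; it is the function induced by F when F is a
   stem function, see slice_induces. *)
Definition slice (F : C -> quatC) (x : quat) : quat :=
  let z : C := (q0 x, qabs (qim x)) in
  qadd (fst (F z)) (qmul (im_unit x) (snd (F z))).

(* f^s, for f induced by the stem function F. *)
Definition symmetrization (F : C -> quatC) : quat -> quat := slice (sym_stem F).

Definition laplacian (u : quat -> R) (x : quat) : R :=
  Derive_n (fun t => u (qadd x (mkq t 0 0 0))) 2 0 +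
  Derive_n (fun t => u (qadd x (mkq 0 t 0 0))) 2 0 +
  Derive_n (fun t => u (qadd x (mkq 0 0 t 0))) 2 0 +
  Derive_n (fun t => u (qadd x (mkq 0 0 0 t))) 2 0.

Definition cone (x : quat) : Prop :=
  exists (a b : R) (I : quat),
    im_sphere I /\ x = qslice a I b /\ b >= Rabs a /\ b <> 0.

Lemma quat_ext (x y : quat) :
  q0 x = q0 y -> q1 x = q1 y -> q2 x = q2 y -> q3 x = q3 y -> x = y.
Proof.
  destruct x as [[[a b] c] d], y as [[[a' b'] c'] d'].
  unfold q0, q1, q2, q3; simpl; intros; subst; reflexivity.
Qed.

Ltac quat_simpl :=
  unfold qslice, qsub, qadd, qopp, qmul, qconj, qreal, qim, mkq, q0, q1, q2, q3
    in *; simpl in *.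
Ltac quat_ring := apply quat_ext; quat_simpl; ring.

Lemma qmul_conj (x : quat) : qmul x (qconj x) = qreal (qabs x ^ 2).
Proof.
  assert (E : qabs x ^ 2 = q0 x ^ 2 + q1 x ^ 2 + q2 x ^ 2 + q3 x ^ 2).
  { unfold qabs. rewrite pow2_sqrt; [ring|].
    pose proof (pow2_ge_0 (q0 x)); pose proof (pow2_ge_0 (q1 x)).
    pose proof (pow2_ge_0 (q2 x)); pose proof (pow2_ge_0 (q3 x)). lra. }
  rewrite E. quat_ring.
Qed.

Lemma im_sphere_components (I : quat) : im_sphere I ->
  q0 I = 0 /\ q1 I ^ 2 + q2 I ^ 2 + q3 I ^ 2 = 1.
Proof.
  destruct I as [[[a b] c] d]. unfold im_sphere. quat_simpl.
  intros E; injection E as E0 E1 E2 E3.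
  destruct (Req_dec a 0) as [-> | Ha]; [split; [reflexivity | lra]|].
  assert (b = 0) by (apply (Rmult_eq_reg_l a); lra).
  assert (c = 0) by (apply (Rmult_eq_reg_l a); lra).
  assert (d = 0) by (apply (Rmult_eq_reg_l a); lra).
  subst. pose proof (Rle_0_sqr a). unfold Rsqr in *. lra.
Qed.

Lemma slice_induces (D : C -> Prop) (F : C -> quatC) :
  stem D F -> induces D F (slice F).
Proof.
  intros HF a b I HD HI.
  destruct (im_sphere_components I HI) as [I0 I1].
  assert (E0 : q0 (qslice a I b) = a) by (quat_simpl; rewrite I0; ring).
  assert (Eim : qim (qslice a I b) = qmul I (qreal b))
    by (apply quat_ext; quat_simpl; rewrite ?I0; ring).
  assert (Eabs : qabs (qim (qslice a I b)) = Rabs b).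
  { rewrite Eim. unfold qabs. rewrite <- (sqrt_Rsqr_abs b). f_equal.
    replace (Rsqr b) with ((q1 I ^ 2 + q2 I ^ 2 + q3 I ^ 2) * b ^ 2)
      by (rewrite I1; unfold Rsqr; ring).
    quat_simpl; rewrite I0; ring. }
  unfold slice, im_unit. rewrite E0, Eabs, Eim.
  destruct (Req_EM_T (Rabs b) 0) as [B0 | B0].
  - assert (b = 0) as -> by (destruct (Req_dec b 0); auto;
      exfalso; apply (Rabs_no_R0 b); auto).
    rewrite Rabs_R0.
    assert (Z : snd (F (a, 0)) = qreal 0).
    { pose proof (HF (a, 0) HD) as E.
      unfold Cconj in E; simpl in E. rewrite Ropp_0 in E.
      apply (f_equal snd) in E. unfold qCbar in E; simpl in E.
      revert E. generalize (snd (F (a, 0))).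
      intros [[[s t] u] v] E. quat_simpl. injection E as E1 E2 E3 E4.
      apply quat_ext; quat_simpl; lra. }
    rewrite Z. quat_ring.
  - destruct (Rle_dec 0 b) as [Hb | Hb].
    + rewrite (Rabs_pos_eq b Hb) in *.
      f_equal. apply (f_equal (fun J => qmul J _)).
      apply quat_ext; quat_simpl; field; exact B0.
    + rewrite (Rabs_left b) in * by lra.
      pose proof (HF (a, b) HD) as E. unfold Cconj in E; simpl in E.
      rewrite E. unfold qCbar; simpl. f_equal.
      apply quat_ext; quat_simpl; field; lra.
Qed.

Lemma sym_stem_stem (D : C -> Prop) (F : C -> quatC) :
  stem D F -> stem D (sym_stem F).
Proof.
  intros HF z Hz. unfold sym_stem. rewrite (HF z Hz).
  destruct (F z) as [p q]. unfold qCmul, qCc, qCbar; simpl.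
  f_equal; quat_ring.
Qed.

(* Main.v *)
Require Import Defs.
From Stdlib Require Import Classical Reals Lra Psatz.
From Coquelicot Require Import Coquelicot.
Open Scope R_scope.

(** Writing the stem function as [F = p + \imath q], put [F_j = p_j + i q_j] for the
    four coordinates.  Then [F^c F = g := F_0^2 + F_1^2 + F_2^2 + F_3^2] is a complex
    holomorphic function, [|f^s(x)| = |g(Re x, |Im x|)|], and harmonicity of
    [ln |g|] gives [Delta ln |f^s| (0) = -2 Re (g'/g)'(0)].  The zeros of [g] are
    those of [f], they come in conjugate pairs, have [Re a^2 <= 0], and [|g| <= 1]
    on the unit disc.

    If [k] has no zeros, the mean of [ln |k|] against [1 - cos 2 theta >= 0] on the
    circle of radius [s] equals [J(k) = ln |k(0)| - s^2/4 Re (k'/k)'(0)], so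
    [J(k) <= 0].  Dividing [k] by the Blaschke factor of a zero [a] with
    [Re a^2 <= 0] keeps [|k| <= 1] and increases [J] by at least [- ln |a|], and it
    multiplies [|k(0)|] by [1/|a|], so that finitely many divisions remove all zeros
    from a smaller disc.  Removing a conjugate pair [a], [Cconj a] first yields
    [J(g) <= 2 ln |a|], which is the claim as [s -> 1]. *)

Ltac ceq :=
  cbv beta;
  repeat match goal with x : UniformSpace.sort C_UniformSpace |- _ => change C in x end;
  lazymatch goal with |- @eq _ ?a ?b => change (@eq C a b) end.
Ltac cring := ceq; ring.
Ltac cfield := ceq; field.

Lemma continuous_C {U : UniformSpace} (f : U -> C) (x : U) :
  continuous (fun y => fst (f y)) x -> continuous (fun y => snd (f y)) x ->
  continuous f x.
Proof.
  intros H1 H2. apply continuous_ext with (fun y => (fst (f y), snd (f y))).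
  - intros y; symmetry; apply surjective_pairing.
  - apply (continuous_comp_2 (fun y => fst (f y)) (fun y => snd (f y))
      (fun a b => (a, b))); auto.
    apply continuous_ext with (fun p : R * R => p).
    + intros p; apply surjective_pairing.
    + apply continuous_id.
Qed.

Lemma continuous_re {U : UniformSpace} (f : U -> C) (x : U) :
  continuous f x -> continuous (fun y => fst (f y)) x.
Proof.
  intros H. apply (continuous_comp f fst); [exact H|].
  destruct (f x); apply continuous_fst.
Qed.

Lemma continuous_im {U : UniformSpace} (f : U -> C) (x : U) :
  continuous f x -> continuous (fun y => snd (f y)) x.
Proof.
  intros H. apply (continuous_comp f snd); [exact H|].
  destruct (f x); apply continuous_snd.
Qed.

Lemma continuous_Rmult {U : UniformSpace} (f g : U -> R) (x : U) :
  continuous f x -> continuous g x -> continuous (fun y => f y * g y) x.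
Proof. exact (continuous_mult (K := R_AbsRing) f g x). Qed.

Lemma continuous_Rplus {U : UniformSpace} (f g : U -> R) (x : U) :
  continuous f x -> continuous g x -> continuous (fun y => f y + g y) x.
Proof. exact (continuous_plus (V := R_NormedModule) f g x). Qed.

Lemma continuous_Rminus {U : UniformSpace} (f g : U -> R) (x : U) :
  continuous f x -> continuous g x -> continuous (fun y => f y - g y) x.
Proof. exact (continuous_minus (V := R_NormedModule) f g x). Qed.

Lemma continuous_Cplus {U : UniformSpace} (f g : U -> C) (x : U) :
  continuous f x -> continuous g x -> continuous (fun y => (f y + g y)%C) x.
Proof.
  intros Hf Hg; apply continuous_C; simpl; apply continuous_Rplus;
    auto using continuous_re, continuous_im.
Qed.

Lemma continuous_Cmult {U : UniformSpace} (f g : U -> C) (x : U) :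
  continuous f x -> continuous g x -> continuous (fun y => (f y * g y)%C) x.
Proof.
  intros Hf Hg; apply continuous_C; simpl;
    [apply continuous_Rminus | apply continuous_Rplus];
    apply continuous_Rmult; auto using continuous_re, continuous_im.
Qed.

Lemma continuous_Copp {U : UniformSpace} (f : U -> C) (x : U) :
  continuous f x -> continuous (fun y => (- f y)%C) x.
Proof.
  intros Hf. apply continuous_ext with (fun y => (RtoC (-1) * f y)%C).
  - intros y; cring.
  - apply continuous_Cmult; auto. apply continuous_const.
Qed.

Lemma continuous_Cminus {U : UniformSpace} (f g : U -> C) (x : U) :
  continuous f x -> continuous g x -> continuous (fun y => (f y - g y)%C) x.
Proof.
  intros Hf Hg; apply continuous_Cplus; auto. now apply continuous_Copp.
Qed.

Lemma normsq_pos (z : C) : z <> 0%C -> 0 < fst z ^ 2 + snd z ^ 2.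
Proof.
  intros H. destruct z as [a b]; simpl.
  destruct (Req_dec a 0) as [-> | Ha].
  - destruct (Req_dec b 0) as [-> | Hb]; [now elim H|].
    pose proof (Rsqr_pos_lt b Hb); unfold Rsqr in *; lra.
  - pose proof (Rsqr_pos_lt a Ha); pose proof (Rle_0_sqr b); unfold Rsqr in *; lra.
Qed.

Lemma continuous_Cinv {U : UniformSpace} (f : U -> C) (x : U) :
  continuous f x -> f x <> 0%C -> continuous (fun y => (/ f y)%C) x.
Proof.
  intros Hf H0. pose proof (normsq_pos _ H0) as P.
  assert (K : continuous (fun y => / (fst (f y) ^ 2 + snd (f y) ^ 2)) x).
  { apply (continuous_comp (fun y => fst (f y) ^ 2 + snd (f y) ^ 2) Rinv).
    - simpl. apply continuous_Rplus; repeat apply continuous_Rmult;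
        auto using continuous_re, continuous_im, continuous_const.
    - apply continuous_Rinv. lra. }
  apply continuous_C; simpl; unfold Rdiv.
  - apply continuous_Rmult; [now apply continuous_re|exact K].
  - apply continuous_Rmult; [|exact K].
    apply (continuous_opp (V := R_NormedModule)). now apply continuous_im.
Qed.

Lemma continuous_Cdiv {U : UniformSpace} (f g : U -> C) (x : U) :
  continuous f x -> continuous g x -> g x <> 0%C ->
  continuous (fun y => (f y / g y)%C) x.
Proof.
  intros; apply continuous_Cmult; auto. now apply continuous_Cinv.
Qed.

Lemma continuous_RtoC {U : UniformSpace} (f : U -> R) (x : U) :
  continuous f x -> continuous (fun y => RtoC (f y)) x.
Proof. intros; apply continuous_C; simpl; auto. apply continuous_const. Qed.

Lemma continuous_Cmod {U : UniformSpace} (f : U -> C) (x : U) :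
  continuous f x -> continuous (fun y => Cmod (f y)) x.
Proof.
  intros Hf. unfold Cmod.
  apply (continuous_comp (fun y => fst (f y) ^ 2 + snd (f y) ^ 2) sqrt).
  - simpl. apply continuous_Rplus; repeat apply continuous_Rmult;
      auto using continuous_re, continuous_im, continuous_const.
  - apply continuous_sqrt.
Qed.

Lemma locally_lt {U : UniformSpace} (f : U -> R) (x : U) (R0 : R) :
  continuous f x -> f x < R0 -> locally x (fun y => f y < R0).
Proof. intros Hf H. exact (Hf (fun r => r < R0) (open_lt R0 _ H)). Qed.

Lemma locally_disc (R0 : R) (z : C) :
  Cmod z < R0 -> locally z (fun w => Cmod w < R0).
Proof.
  intros H. apply (locally_lt (fun w : C => Cmod w)); auto.
  apply continuous_Cmod, continuous_id.
Qed.

Lemma locally_neq0 {U : UniformSpace} (f : U -> C) (x : U) :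
  continuous f x -> f x <> 0%C -> locally x (fun y => f y <> 0%C).
Proof.
  intros Hf H. apply Cmod_gt_0 in H.
  assert (K : locally x (fun y => 0 < Cmod (f y))).
  { exact (continuous_Cmod f x Hf (fun r => 0 < r) (open_gt 0 _ H)). }
  revert K; apply filter_imp. intros y; apply Cmod_gt_0.
Qed.

Lemma continuous_punctured_eq (f g : C -> C) (z : C) :
  continuous f z -> continuous g z ->
  locally z (fun w => w <> z -> f w = g w) -> f z = g z.
Proof.
  intros Hf Hg H.
  destruct (Ceq_dec (f z) (g z)) as [E|E]; [exact E|exfalso].
  assert (N : (f z - g z)%C <> 0%C).
  { intros Z; apply E. replace (f z) with ((f z - g z) + g z)%C by ring.
    rewrite Z; cring. }
  pose proof (locally_neq0 (fun w => (f w - g w)%C) z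
    (continuous_Cminus _ _ _ Hf Hg) N) as [d1 H1].
  destruct H as [d2 H2].
  set (e := Rmin d1 d2 / 2).
  assert (e1 : 0 < e /\ e < d1 /\ e < d2).
  { destruct d1 as [d1 p1], d2 as [d2 p2]; unfold e; simpl.
    pose proof (Rmin_l d1 d2); pose proof (Rmin_r d1 d2).
    assert (0 < Rmin d1 d2) by now apply Rmin_glb_lt. lra. }
  destruct e1 as [e0 [e1 e2]].
  set (w := (fst z + e, snd z) : C).
  assert (B : forall d : posreal, e < d -> ball z d w).
  { intros d Hd. split; simpl; unfold ball; simpl; unfold AbsRing_ball, abs, minus, plus, opp; simpl.
    - replace (fst z + e + - fst z) with e by ring. rewrite Rabs_pos_eq; lra.
    - replace (snd z + - snd z) with 0 by ring. rewrite Rabs_R0; apply cond_pos. }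
  apply (H1 w); [now apply B|].
  rewrite (H2 w); [cring|now apply B|].
  intros W. apply (f_equal fst) in W. simpl in W. lra.
Qed.

(** * Complex differentiability *)

(* Caratheodory's form: all differentiation rules reduce to algebra and continuity. *)
Definition cdiff (k : C -> C) (z d : C) : Prop :=
  exists phi : C -> C, continuous phi z /\ phi z = d /\
    locally z (fun w => k w = (k z + phi w * (w - z))%C).

Lemma cdiff_continuous k z d : cdiff k z d -> continuous k z.
Proof.
  intros (phi & Hc & _ & H).
  apply (continuous_ext_loc k (fun w => (k z + phi w * (w - z))%C)).
  - revert H; apply filter_imp; now intros w ->.
  - apply continuous_Cplus; [apply continuous_const|].
    apply continuous_Cmult; [exact Hc|].
    apply continuous_Cminus; [apply continuous_id|apply continuous_const].
Qed.

Lemma cdiff_unique k z d d' : cdiff k z d -> cdiff k z d' -> d = d'.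
Proof.
  intros (p & Hc & <- & H) (p' & Hc' & <- & H').
  apply continuous_punctured_eq; auto.
  generalize (filter_and _ _ H H'); apply filter_imp.
  intros w [E E'] W. rewrite E in E'.
  assert (N : (w - z)%C <> 0%C).
  { intros Z; apply W. replace w with ((w - z) + z)%C by ring. rewrite Z; cring. }
  assert (E2 : (p w * (w - z) = p' w * (w - z))%C).
  { transitivity ((k z + p w * (w - z)) - k z)%C; [cring|]. rewrite E'; cring. }
  transitivity (p w * (w - z) / (w - z))%C; [now cfield|].
  rewrite E2; now cfield.
Qed.

Lemma cdiff_ext_loc k l z d :
  locally z (fun w => k w = l w) -> cdiff k z d -> cdiff l z d.
Proof.
  intros E (p & Hc & Hd & H). exists p; split; [auto|split; [auto|]].
  pose proof (locally_singleton _ _ E) as Ez. simpl in Ez.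
  generalize (filter_and _ _ E H); apply filter_imp.
  intros w [E1 E2]. now rewrite <- E1, <- Ez.
Qed.

Lemma cdiff_const c z : cdiff (fun _ => c) z 0%C.
Proof.
  exists (fun _ => 0%C); split; [apply continuous_const|split; [reflexivity|]].
  apply filter_forall; intros; cring.
Qed.

Lemma cdiff_id z : cdiff (fun w => w) z 1%C.
Proof.
  exists (fun _ => 1%C); split; [apply continuous_const|split; [reflexivity|]].
  apply filter_forall; intros; cring.
Qed.

Lemma cdiff_plus k l z d e :
  cdiff k z d -> cdiff l z e -> cdiff (fun w => (k w + l w)%C) z (d + e)%C.
Proof.
  intros (p & Hc & <- & H) (p' & Hc' & <- & H').
  exists (fun w => (p w + p' w)%C).
  split; [now apply continuous_Cplus|split; [reflexivity|]].
  generalize (filter_and _ _ H H'); apply filter_imp.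
  intros w [-> ->]; cring.
Qed.

Lemma cdiff_mult k l z d e :
  cdiff k z d -> cdiff l z e ->
  cdiff (fun w => (k w * l w)%C) z (d * l z + k z * e)%C.
Proof.
  intros Hk Hl. pose proof (cdiff_continuous _ _ _ Hl) as Cl.
  destruct Hk as (p & Hc & <- & H). destruct Hl as (p' & Hc' & <- & H').
  exists (fun w => (p w * l w + k z * p' w)%C).
  split; [|split; [reflexivity|]].
  - apply continuous_Cplus; apply continuous_Cmult; auto. apply continuous_const.
  - generalize (filter_and _ _ H H'); apply filter_imp.
    intros w [E E']. rewrite E.
    transitivity (k z * l w + p w * (w - z) * l w)%C; [cring|].
    rewrite E' at 1. cring.
Qed.

Lemma cdiff_inv k z d :
  cdiff k z d -> k z <> 0%C -> cdiff (fun w => (/ k w)%C) z (- d / (k z * k z))%C.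
Proof.
  intros Hk N. pose proof (cdiff_continuous _ _ _ Hk) as Ck.
  pose proof (locally_neq0 k z Ck N) as Ln.
  destruct Hk as (p & Hc & <- & H).
  exists (fun w => (- p w / (k w * k z))%C).
  split; [|split; [reflexivity|]].
  - apply continuous_Cdiv; [now apply continuous_Copp| |now apply Cmult_neq_0].
    apply continuous_Cmult; auto. apply continuous_const.
  - generalize (filter_and _ _ H Ln); apply filter_imp.
    intros w [E Nw].
    assert (E2 : (p w * (w - z) = k w - k z)%C) by (rewrite E; cring).
    transitivity (/ k z - (p w * (w - z)) / (k w * k z))%C.
    + rewrite E2. cfield. split; auto.
    + cfield. split; auto.
Qed.

Lemma cdiff_comp k l z d e :
  cdiff l z e -> cdiff k (l z) d -> cdiff (fun w => k (l w)) z (d * e)%C.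
Proof.
  intros Hl. pose proof (cdiff_continuous _ _ _ Hl) as Cl.
  destruct Hl as (p & Hc & <- & H). intros (p' & Hc' & <- & H').
  exists (fun w => (p' (l w) * p w)%C).
  split; [|split; [reflexivity|]].
  - apply continuous_Cmult; auto. now apply (continuous_comp l p').
  - generalize (filter_and _ _ H (Cl _ H')); apply filter_imp.
    intros w [E E']. rewrite E'. rewrite E at 2. cring.
Qed.

(** * Complex-valued functions of a real variable *)

Definition rdiff (g : R -> C) (t : R) (d : C) : Prop :=
  is_derive (fun u => fst (g u)) t (fst d) /\
  is_derive (fun u => snd (g u)) t (snd d).

Lemma is_derive_caratheodory (f : R -> R) (t l : R) :
  is_derive f t l <->
  exists psi : R -> R, continuous psi t /\ psi t = l /\
    locally t (fun u => f u = f t + psi u * (u - t)).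
Proof.
  split.
  - intros H. apply is_derive_Reals in H.
    exists (fun u => if Req_EM_T u t then l else (f u - f t) / (u - t)).
    split; [|split].
    + apply continuity_pt_filterlim. intros eps Heps.
      destruct (H eps Heps) as [delta Hd].
      exists delta; split; [apply cond_pos|].
      intros u [[_ Hu] Hut]. change R in u. simpl. unfold Rdist in *.
      destruct (Req_EM_T t t) as [_|]; [|lra].
      destruct (Req_EM_T u t) as [->|N]; [lra|].
      simpl in Hut. unfold Rdist in Hut.
      specialize (Hd (u - t) ltac:(lra) Hut).
      now replace (t + (u - t)) with u in Hd by ring.
    + destruct (Req_EM_T t t); lra.
    + apply filter_forall; intros u.
      destruct (Req_EM_T u t) as [->|N]; [ring|field; lra].
  - intros (psi & Hc & <- & H).
    apply (is_derive_ext_loc (fun u => f t + psi u * (u - t))).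
    { revert H; apply filter_imp; now intros u ->. }
    apply is_derive_Reals. intros eps Heps.
    apply continuity_pt_filterlim in Hc.
    destruct (Hc eps Heps) as [delta [Hd0 Hd]].
    exists (mkposreal delta Hd0). simpl. intros h Hh Hhd.
    replace ((f t + psi (t + h) * (t + h - t) - (f t + psi t * (t - t))) / h - psi t)
      with (psi (t + h) - psi t) by (field; auto).
    apply (Hd (t + h)). simpl; unfold Rdist. split; [split; [exact I|lra]|].
    now replace (t + h - t) with h by ring.
Qed.

Lemma rdiff_caratheodory (g : R -> C) (t : R) (d : C) :
  rdiff g t d <->
  exists psi : R -> C, continuous psi t /\ psi t = d /\
    locally t (fun u => g u = (g t + psi u * RtoC (u - t))%C).
Proof.
  unfold rdiff; rewrite !is_derive_caratheodory. split.
  - intros [(p & Hp & Ep & H) (q & Hq & Eq & H')].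
    exists (fun u => (p u, q u) : C). split; [|split].
    + now apply continuous_C.
    + rewrite Ep, Eq. symmetry; apply surjective_pairing.
    + generalize (filter_and _ _ H H'); apply filter_imp.
      intros u [E E']. apply injective_projections; simpl.
      * rewrite E; ring.
      * rewrite E'; ring.
  - intros (p & Hp & <- & H). split.
    + exists (fun u => fst (p u)); split; [now apply continuous_re|split; [auto|]].
      revert H; apply filter_imp; intros u ->; simpl; ring.
    + exists (fun u => snd (p u)); split; [now apply continuous_im|split; [auto|]].
      revert H; apply filter_imp; intros u ->; simpl; ring.
Qed.

Lemma rdiff_continuous g t d : rdiff g t d -> continuous g t.
Proof.
  intros [H1 H2]. apply continuous_C.
  - apply (ex_derive_continuous (V := R_NormedModule) (fun u => fst (g u))). now exists (fst d).
  - apply (ex_derive_continuous (V := R_NormedModule) (fun u => snd (g u))). now exists (snd d).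
Qed.

Lemma cdiff_rdiff_comp k g t d e :
  rdiff g t e -> cdiff k (g t) d -> rdiff (fun u => k (g u)) t (d * e)%C.
Proof.
  intros Hg. pose proof (rdiff_continuous _ _ _ Hg) as Cg.
  apply rdiff_caratheodory in Hg. destruct Hg as (p & Hp & <- & H).
  intros (q & Hq & <- & H'). apply rdiff_caratheodory.
  exists (fun u => (q (g u) * p u)%C). split; [|split; [reflexivity|]].
  - apply continuous_Cmult; auto. now apply (continuous_comp g q).
  - generalize (filter_and _ _ H (Cg _ H')); apply filter_imp.
    intros u [E E']. rewrite E'. rewrite E at 2. cring.
Qed.

Lemma rdiff_const c t : rdiff (fun _ => c) t 0%C.
Proof. split; simpl; apply (is_derive_const (V := R_NormedModule)). Qed.

Lemma rdiff_RtoC t : rdiff RtoC t 1%C.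
Proof.
  split; simpl; [apply (is_derive_id (K := R_AbsRing))|
    apply (is_derive_const (V := R_NormedModule))].
Qed.

Lemma rdiff_plus g h t d e :
  rdiff g t d -> rdiff h t e -> rdiff (fun u => (g u + h u)%C) t (d + e)%C.
Proof.
  rewrite !rdiff_caratheodory.
  intros (p & Hc & <- & H) (p' & Hc' & <- & H').
  exists (fun w => (p w + p' w)%C).
  split; [now apply continuous_Cplus|split; [reflexivity|]].
  generalize (filter_and _ _ H H'); apply filter_imp.
  intros w [-> ->]; cring.
Qed.

Lemma rdiff_mult g h t d e :
  rdiff g t d -> rdiff h t e ->
  rdiff (fun u => (g u * h u)%C) t (d * h t + g t * e)%C.
Proof.
  intros Hg Hh. pose proof (rdiff_continuous _ _ _ Hh) as Ch.
  revert Hg Hh. rewrite !rdiff_caratheodory.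
  intros (p & Hc & <- & H) (p' & Hc' & <- & H').
  exists (fun w => (p w * h w + g t * p' w)%C).
  split; [|split; [reflexivity|]].
  - apply continuous_Cplus; apply continuous_Cmult; auto. apply continuous_const.
  - generalize (filter_and _ _ H H'); apply filter_imp.
    intros w [E E']. rewrite E.
    transitivity (g t * h w + p w * RtoC (w - t) * h w)%C; [cring|].
    rewrite E' at 1. cring.
Qed.

Lemma rdiff_eq g t d d' : rdiff g t d -> d = d' -> rdiff g t d'.
Proof. now intros H <-. Qed.

Lemma cdiff_eq k z d d' : cdiff k z d -> d = d' -> cdiff k z d'.
Proof. now intros H <-. Qed.

Lemma rdiff_ext g h t d : (forall u, g u = h u) -> rdiff g t d -> rdiff h t d.
Proof.
  intros E [H1 H2]; split; [revert H1|revert H2]; apply is_derive_ext;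
    intros u; now rewrite E.
Qed.

(** * Integrals over the circle *)

Ltac rring := lazymatch goal with |- @eq _ ?a ?b => change (@eq R a b) end; ring.

Definition Cint (f : R -> C) : C :=
  (RInt (fun t => fst (f t)) 0 (2 * PI), RInt (fun t => snd (f t)) 0 (2 * PI)).

Definition rcont (f : R -> C) : Prop := forall t, continuous f t.

Lemma two_PI_pos : 0 < 2 * PI.
Proof. pose proof PI_RGT_0; lra. Qed.

Lemma ex_RInt_cont (f : R -> R) (a b : R) : (forall t, continuous f t) -> ex_RInt f a b.
Proof. intros H. apply (ex_RInt_continuous (V := R_CompleteNormedModule)). auto. Qed.

Lemma Cint_ext f g : (forall t, f t = g t) -> Cint f = Cint g.
Proof.
  intros E; unfold Cint; f_equal; apply RInt_ext; intros t _; now rewrite E.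
Qed.

Lemma RInt_lin (f g : R -> R) (a b x y : R) :
  (forall t, continuous f t) -> (forall t, continuous g t) ->
  RInt (fun t => x * f t + y * g t) a b = x * RInt f a b + y * RInt g a b.
Proof.
  intros Hf Hg. apply is_RInt_unique.
  apply (is_RInt_plus (V := R_NormedModule) (fun t => x * f t) (fun t => y * g t));
    apply (is_RInt_scal (V := R_NormedModule)), (RInt_correct (V := R_CompleteNormedModule));
    now apply ex_RInt_cont.
Qed.

Lemma Cint_plus f g :
  rcont f -> rcont g -> Cint (fun t => (f t + g t)%C) = (Cint f + Cint g)%C.
Proof.
  intros Hf Hg. unfold Cint. apply injective_projections; simpl.
  - rewrite <- (Rmult_1_l (RInt (fun t => fst (f t)) _ _)),
      <- (Rmult_1_l (RInt (fun t => fst (g t)) _ _)), <- RInt_lin;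
      [|intros; now apply continuous_re..].
    apply RInt_ext; intros; simpl; rring.
  - rewrite <- (Rmult_1_l (RInt (fun t => snd (f t)) _ _)),
      <- (Rmult_1_l (RInt (fun t => snd (g t)) _ _)), <- RInt_lin;
      [|intros; now apply continuous_im..].
    apply RInt_ext; intros; simpl; rring.
Qed.

Lemma Cint_scal c f : rcont f -> Cint (fun t => (c * f t)%C) = (c * Cint f)%C.
Proof.
  intros Hf. unfold Cint. apply injective_projections; simpl.
  - transitivity (fst c * RInt (fun t => fst (f t)) 0 (2 * PI)
      + (- snd c) * RInt (fun t => snd (f t)) 0 (2 * PI)); [|simpl; ring].
    rewrite <- RInt_lin; [|intros; now apply continuous_re|intros; now apply continuous_im].
    apply RInt_ext; intros; simpl; rring.
  - rewrite <- RInt_lin; [|intros; now apply continuous_im|intros; now apply continuous_re].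
    reflexivity.
Qed.

Lemma Cint_minus f g :
  rcont f -> rcont g -> Cint (fun t => (f t - g t)%C) = (Cint f - Cint g)%C.
Proof.
  intros Hf Hg.
  rewrite (Cint_ext _ (fun t => (f t + RtoC (-1) * g t)%C)) by (intros; ring).
  rewrite Cint_plus, Cint_scal; auto.
  - ring.
  - intros t; apply continuous_Cmult; auto. apply continuous_const.
Qed.

Lemma Cint_const c : Cint (fun _ => c) = (RtoC (2 * PI) * c)%C.
Proof.
  unfold Cint. rewrite !RInt_const. unfold scal; simpl; unfold mult; simpl.
  apply injective_projections; simpl; ring.
Qed.

Lemma Cint_bound f M :
  rcont f -> (forall t, 0 <= t <= 2 * PI -> Cmod (f t) <= M) -> Cmod (Cint f) <= 4 * PI * M.
Proof.
  intros Hf HM. pose proof two_PI_pos.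
  assert (A : Rabs (fst (Cint f)) <= (2 * PI - 0) * M).
  { unfold Cint; simpl. apply abs_RInt_le_const; [lra| |].
    - apply ex_RInt_cont; intros; now apply continuous_re.
    - intros t Ht. apply Rle_trans with (2 := HM t Ht). apply (re_le_Cmod (f t)). }
  assert (B : Rabs (snd (Cint f)) <= (2 * PI - 0) * M).
  { unfold Cint; simpl. apply abs_RInt_le_const; [lra| |].
    - apply ex_RInt_cont; intros; now apply continuous_im.
    - intros t Ht. apply Rle_trans with (2 := HM t Ht).
      apply Rle_trans with (2 := Rmax_Cmod (f t)). apply Rmax_r. }
  assert (T : Cmod (Cint f) <= Rabs (fst (Cint f)) + Rabs (snd (Cint f))).
  { replace (Cint f) with (RtoC (fst (Cint f)) + Ci * RtoC (snd (Cint f)))%C at 1.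
    - eapply Rle_trans; [apply Cmod_triangle|].
      rewrite Cmod_mult, Cmod_Ci, !Cmod_R. lra.
    - apply injective_projections; simpl; ring. }
  lra.
Qed.

Lemma RInt_derive_periodic (G N : R -> R) :
  (forall t, is_derive G t (N t)) -> (forall t, continuous N t) ->
  G 0 = G (2 * PI) -> RInt N 0 (2 * PI) = 0.
Proof.
  intros HG HN E. apply is_RInt_unique.
  replace 0 with (minus (G (2 * PI)) (G 0)) at 2.
  - apply (is_RInt_derive (V := R_CompleteNormedModule)); auto.
  - rewrite E. unfold minus, plus, opp; simpl. rring.
Qed.

Lemma Cint_derive_periodic (G N : R -> C) :
  (forall t, rdiff G t (N t)) -> rcont N -> G 0 = G (2 * PI) -> Cint N = 0%C.
Proof.
  intros HG HN E. unfold Cint.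
  rewrite (RInt_derive_periodic (fun t => fst (G t))),
    (RInt_derive_periodic (fun t => snd (G t))); [reflexivity|..].
  all: try (intros t; apply HG); try now rewrite E.
  - intros; now apply continuous_im.
  - intros; now apply continuous_re.
Qed.

Lemma RInt_homotopy (f n : R -> R -> R) (a b : R) :
  a < 0 -> 1 < b ->
  (forall t u, a < t < b -> is_derive (fun x => f x u) t (n t u)) ->
  (forall t u, a < t < b ->
    continuous (fun p : R * R => n (fst p) (snd p)) (t, u)) ->
  (forall t u, a < t < b -> continuous (f t) u) ->
  (forall t, a < t < b -> RInt (n t) 0 (2 * PI) = 0) ->
  RInt (f 0) 0 (2 * PI) = RInt (f 1) 0 (2 * PI).
Proof.
  intros Ha Hb Hd Hn Hc Hz.
  assert (L : forall t, a < t < b -> locally t (fun x => a < x < b)).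
  { intros t [h1 h2]. apply (filter_and (fun x => a < x) (fun x => x < b)).
    - exact (open_gt a t h1).
    - exact (open_lt b t h2). }
  apply (eq_is_derive (V := R_NormedModule) (fun t => RInt (f t) 0 (2 * PI)) 0 1);
    [|lra].
  intros t Ht. assert (Ht' : a < t < b) by lra.
  assert (DE : forall x u, a < x < b -> Derive (fun z => f z u) x = n x u).
  { intros x u Hx. apply is_derive_unique. now apply Hd. }
  replace (zero : R_NormedModule) with (RInt (fun u => Derive (fun z => f z u) t) 0 (2 * PI)).
  - apply (is_derive_RInt_param f 0 (2 * PI) t).
    + generalize (L t Ht'); apply filter_imp. intros x Hx u _. eexists; now apply Hd.
    + intros u _. apply continuity_2d_pt_filterlim.
      rewrite (DE t u Ht').
      apply (filterlim_ext_loc (fun p : R * R => n (fst p) (snd p))); [|now apply Hn].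
      assert (Lp : locally (t, u) (fun p : R * R => a < fst p < b)).
      { exact (continuous_fst t u _ (L t Ht')). }
      revert Lp; apply filter_imp. intros p Hp. symmetry. now apply DE.
    + generalize (L t Ht'); apply filter_imp. intros x Hx.
      apply ex_RInt_cont; intros u; now apply Hc.
  - transitivity (RInt (n t) 0 (2 * PI)); [|now apply Hz].
    apply RInt_ext; intros; now apply DE.
Qed.

Lemma Cint_homotopy (H N : R -> R -> C) (a b : R) :
  a < 0 -> 1 < b ->
  (forall t u, a < t < b -> rdiff (fun x => H x u) t (N t u)) ->
  (forall t u, a < t < b ->
    continuous (fun p : R * R => N (fst p) (snd p)) (t, u)) ->
  (forall t, a < t < b -> rcont (H t)) ->
  (forall t, a < t < b -> Cint (N t) = 0%C) ->
  Cint (H 0) = Cint (H 1).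
Proof.
  intros Ha Hb Hd Hn Hc Hz. unfold Cint. f_equal.
  - apply (RInt_homotopy (fun t u => fst (H t u)) (fun t u => fst (N t u)) a b);
      auto; intros.
    + now apply Hd.
    + now apply (continuous_re (fun p : R * R => N (fst p) (snd p))), Hn.
    + now apply continuous_re, Hc.
    + apply (f_equal fst (Hz t H0)).
  - apply (RInt_homotopy (fun t u => snd (H t u)) (fun t u => snd (N t u)) a b);
      auto; intros.
    + now apply Hd.
    + now apply (continuous_im (fun p : R * R => N (fst p) (snd p))), Hn.
    + now apply continuous_im, Hc.
    + apply (f_equal snd (Hz t H0)).
Qed.

Definition circ (s t : R) : C := (s * cos t, s * sin t).

Lemma Cmod_circ s t : 0 <= s -> Cmod (circ s t) = s.
Proof.
  intros Hs. unfold Cmod, circ; simpl.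
  replace (_ + _) with (s * s * (Rsqr (sin t) + Rsqr (cos t))) by (unfold Rsqr; ring).
  rewrite sin2_cos2, Rmult_1_r. now apply sqrt_square.
Qed.

Lemma circ_0 s : circ s 0 = circ s (2 * PI).
Proof. unfold circ. now rewrite cos_0, sin_0, cos_2PI, sin_2PI. Qed.

Lemma rdiff_circ s t : rdiff (circ s) t (Ci * circ s t)%C.
Proof.
  unfold circ; split; simpl; auto_derive; auto; ring.
Qed.

Lemma continuous_circ s t : continuous (circ s) t.
Proof. eapply rdiff_continuous, rdiff_circ. Qed.

Lemma Cmod_neq0 (z : C) : 0 < Cmod z -> z <> 0%C.
Proof. apply Cmod_gt_0. Qed.

Lemma circ_neq s t z : 0 <= s -> Cmod z < s -> (circ s t - z)%C <> 0%C.
Proof.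
  intros Hs Hz E.
  assert (circ s t = z) as Ez.
  { replace z with (circ s t - (circ s t - z))%C by ring. rewrite E; ring. }
  rewrite <- Ez, Cmod_circ in Hz; lra.
Qed.

Lemma circ_neq0 s t : 0 < s -> circ s t <> 0%C.
Proof. intros Hs; apply Cmod_neq0; rewrite Cmod_circ; lra. Qed.

(** * Cauchy's formula *)

Definition holo (r : R) (k k1 : C -> C) : Prop :=
  forall z : C, Cmod z < r -> cdiff k z (k1 z) /\ continuous k1 z.

Lemma holo_mono r s k k1 : s <= r -> holo r k k1 -> holo s k k1.
Proof. intros H Hk z Hz. apply Hk; lra. Qed.

Lemma holo_continuous r k k1 z : holo r k k1 -> Cmod z < r -> continuous k z.
Proof. intros Hk Hz. eapply cdiff_continuous. now apply Hk. Qed.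

Lemma holo_eq r k k1 l l1 :
  (forall z, Cmod z < r -> k z = l z) -> (forall z, Cmod z < r -> k1 z = l1 z) ->
  holo r k k1 -> holo r l l1.
Proof.
  intros E E1 Hk z Hz. destruct (Hk z Hz) as [H1 H2]. split.
  - rewrite <- E1; auto. revert H1; apply cdiff_ext_loc.
    generalize (locally_disc r z Hz); apply filter_imp; auto.
  - apply (continuous_ext_loc l1 k1); auto.
    generalize (locally_disc r z Hz); apply filter_imp; auto.
Qed.

Lemma holo_const r c : holo r (fun _ => c) (fun _ => 0%C).
Proof. intros z _; split; [apply cdiff_const|apply continuous_const]. Qed.

Lemma holo_id r : holo r (fun z => z) (fun _ => 1%C).
Proof. intros z _; split; [apply cdiff_id|apply continuous_const]. Qed.

Lemma holo_plus r k k1 l l1 :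
  holo r k k1 -> holo r l l1 ->
  holo r (fun z => (k z + l z)%C) (fun z => (k1 z + l1 z)%C).
Proof.
  intros Hk Hl z Hz. destruct (Hk z Hz), (Hl z Hz).
  split; [now apply cdiff_plus|now apply continuous_Cplus].
Qed.

Lemma holo_mult r k k1 l l1 :
  holo r k k1 -> holo r l l1 ->
  holo r (fun z => (k z * l z)%C) (fun z => (k1 z * l z + k z * l1 z)%C).
Proof.
  intros Hk Hl z Hz. pose proof (holo_continuous _ _ _ z Hk Hz).
  pose proof (holo_continuous _ _ _ z Hl Hz).
  destruct (Hk z Hz), (Hl z Hz).
  split; [now apply cdiff_mult|].
  apply continuous_Cplus; now apply continuous_Cmult.
Qed.

Lemma holo_inv r k k1 :
  holo r k k1 -> (forall z, Cmod z < r -> k z <> 0%C) ->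
  holo r (fun z => (/ k z)%C) (fun z => (- k1 z / (k z * k z))%C).
Proof.
  intros Hk N z Hz. pose proof (holo_continuous _ _ _ z Hk Hz).
  destruct (Hk z Hz). split; [now apply cdiff_inv; auto|].
  apply continuous_Cdiv; [now apply continuous_Copp|now apply continuous_Cmult|].
  apply Cmult_neq_0; auto.
Qed.

Lemma holo_pow r k k1 n :
  holo r k k1 -> exists l1, holo r (fun z => (k z ^ n)%C) l1.
Proof.
  intros Hk. induction n as [|n [l1 IH]].
  - exists (fun _ => 0%C). exact (holo_const r 1%C).
  - eexists. simpl. exact (holo_mult _ _ _ _ _ Hk IH).
Qed.

Lemma rcont_circ_comp r k k1 s :
  holo r k k1 -> 0 <= s < r -> rcont (fun t => k (circ s t)).
Proof.
  intros Hk Hs t. apply (continuous_comp (circ s) k); [apply continuous_circ|].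
  eapply holo_continuous; eauto. rewrite Cmod_circ; lra.
Qed.

Lemma rcont_circ s : rcont (circ s).
Proof. intros t; apply continuous_circ. Qed.

Lemma rcont_const c : rcont (fun _ => c).
Proof. intros t; apply continuous_const. Qed.

Lemma rcont_mult f g : rcont f -> rcont g -> rcont (fun t => (f t * g t)%C).
Proof. intros Hf Hg t. now apply continuous_Cmult. Qed.

Lemma rcont_minus f g : rcont f -> rcont g -> rcont (fun t => (f t - g t)%C).
Proof. intros Hf Hg t. now apply continuous_Cminus. Qed.

Lemma rcont_div f g :
  rcont f -> rcont g -> (forall t, g t <> 0%C) -> rcont (fun t => (f t / g t)%C).
Proof. intros Hf Hg N t. now apply continuous_Cdiv. Qed.

Lemma rcont_circ_minus s z : rcont (fun t => (circ s t - z)%C).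
Proof. apply rcont_minus; [apply rcont_circ|apply rcont_const]. Qed.

(* Overshoot of the homotopy parameter past [0, 1], where differentiability
   under the integral sign needs a neighbourhood. *)
Lemma segment_overshoot s r (z w : C) t :
  0 < s < r -> Cmod z <= s -> Cmod w <= s ->
  - ((r - s) / (4 * s)) < t < 1 + (r - s) / (4 * s) ->
  Cmod (z + RtoC t * (w - z)) < r.
Proof.
  intros Hs Hz Hw Ht. set (e := (r - s) / (4 * s)) in *.
  assert (He : e * s = (r - s) / 4) by (unfold e; field; lra).
  assert (e0 : 0 < e) by (unfold e; apply Rdiv_lt_0_compat; lra).
  replace (z + RtoC t * (w - z))%C with (RtoC (1 - t) * z + RtoC t * w)%C
    by (rewrite RtoC_minus; ring).
  eapply Rle_lt_trans; [apply Cmod_triangle|]. rewrite !Cmod_mult, !Cmod_R.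
  assert (A : Rabs (1 - t) + Rabs t <= 1 + 2 * e).
  { unfold Rabs; destruct (Rcase_abs (1 - t)), (Rcase_abs t); lra. }
  pose proof (Rabs_pos (1 - t)); pose proof (Rabs_pos t).
  assert (Rabs (1 - t) * Cmod z <= Rabs (1 - t) * s) by now apply Rmult_le_compat_l.
  assert (Rabs t * Cmod w <= Rabs t * s) by now apply Rmult_le_compat_l.
  assert ((Rabs (1 - t) + Rabs t) * s <= (1 + 2 * e) * s) by (apply Rmult_le_compat_r; lra).
  nra.
Qed.

Lemma rdiff_affine z v t : rdiff (fun x => (z + RtoC x * v)%C) t v.
Proof.
  eapply rdiff_eq.
  - apply rdiff_plus; [apply rdiff_const|].
    apply rdiff_mult; [apply rdiff_RtoC|apply rdiff_const].
  - cring.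
Qed.

Lemma rdiff_circ_affine s z c t :
  rdiff (fun u => (z + c * (circ s u - z))%C) t (c * (Ci * circ s t))%C.
Proof.
  eapply rdiff_eq.
  - apply rdiff_plus; [apply rdiff_const|].
    apply rdiff_mult; [apply rdiff_const|].
    apply rdiff_plus; [apply rdiff_circ|apply rdiff_const].
  - cring.
Qed.

Lemma Ci_neq0 : Ci <> 0%C.
Proof. apply Cmod_neq0. rewrite Cmod_Ci; lra. Qed.

Lemma RtoC_neq0 x : x <> 0 -> RtoC x <> 0%C.
Proof. intros H E. apply H. now injection E. Qed.

Lemma kernel_integral s z :
  0 < s -> Cmod z < s ->
  Cint (fun u => (circ s u / (circ s u - z))%C) = RtoC (2 * PI).
Proof.
  intros Hs Hz.
  set (b := (s - Cmod z) / (2 * s)).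
  assert (b0 : 0 < b) by (unfold b; apply Rdiv_lt_0_compat; lra).
  assert (Hb : b * s = (s - Cmod z) / 2) by (unfold b; field; lra).
  pose proof (Cmod_ge_0 z).
  assert (Ht : forall t, - b < t < 1 + b -> Cmod (RtoC t * z) < s).
  { intros t Ht. rewrite Cmod_mult, Cmod_R.
    assert (Rabs t < 1 + b) by (apply Rabs_def1; lra).
    assert (Rabs t * Cmod z <= (1 + b) * Cmod z) by (apply Rmult_le_compat_r; lra).
    nra. }
  assert (N : forall t u, - b < t < 1 + b -> (circ s u - RtoC t * z)%C <> 0%C)
    by (intros; apply circ_neq; [lra|auto]).
  transitivity (Cint (fun u => circ s u / (circ s u - RtoC 1 * z))%C).
  { apply Cint_ext; intros u. do 3 f_equal. cring. }
  rewrite <- (Cint_homotopy (fun t u => circ s u / (circ s u - RtoC t * z))%C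
    (fun t u => circ s u * z / ((circ s u - RtoC t * z) * (circ s u - RtoC t * z)))%C
    (-b) (1 + b)); try lra.
  - rewrite (Cint_ext _ (fun _ => 1%C)).
    + rewrite Cint_const. cring.
    + intros u. pose proof (circ_neq0 s u Hs). cfield.
      replace (circ s u - 0 * z)%C with (circ s u) by cring. auto.
  - intros t u Htb. eapply rdiff_eq.
    + apply (rdiff_mult (fun _ => circ s u)); [apply rdiff_const|].
      apply (cdiff_rdiff_comp (fun w => / w)%C (fun x => circ s u - RtoC x * z)%C).
      * apply (rdiff_ext (fun x => circ s u + RtoC x * (- z))%C); [intros; cring|].
        apply rdiff_affine.
      * apply (cdiff_inv (fun w => w)); [apply cdiff_id|auto].
    + cfield. auto.
  - intros t u Htb.
    apply (continuous_Cdiv (fun p : R * R => circ s (snd p) * z)%C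
      (fun p : R * R => (circ s (snd p) - RtoC (fst p) * z) * (circ s (snd p) - RtoC (fst p) * z))%C).
    + apply continuous_Cmult; [|apply continuous_const].
      apply (continuous_comp snd (circ s)); [apply continuous_snd|apply continuous_circ].
    + apply continuous_Cmult; apply continuous_Cminus;
        try (apply (continuous_comp snd (circ s)); [apply continuous_snd|apply continuous_circ]);
        (apply continuous_Cmult; [|apply continuous_const]);
        apply continuous_RtoC, continuous_fst.
    + simpl. apply Cmult_neq_0; auto.
  - intros t Htb. apply rcont_div; auto; [apply rcont_circ|apply rcont_circ_minus].
  - intros t Htb.
    apply (Cint_derive_periodic (fun u => Ci * z * / (circ s u - RtoC t * z))%C).
    + intros u. eapply rdiff_eq.
      * apply rdiff_mult; [apply rdiff_const|].
        apply (cdiff_rdiff_comp (fun w => / w)%C (fun u => circ s u - RtoC t * z)%C).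
        -- apply rdiff_plus; [apply rdiff_circ|apply rdiff_const].
        -- apply (cdiff_inv (fun w => w)); [apply cdiff_id|auto].
      * cbv beta.
        transitivity (- (Ci * Ci) * (z * circ s u) /
          ((circ s u - RtoC t * z) * (circ s u - RtoC t * z)))%C; [cfield; auto|].
        replace (Ci * Ci)%C with (RtoC (-1)) by (apply injective_projections; simpl; ring).
        cfield; auto.
    + apply rcont_div; [apply rcont_mult; [apply rcont_circ|apply rcont_const]| |].
      * apply rcont_mult; apply rcont_circ_minus.
      * intros u; apply Cmult_neq_0; auto.
    + now rewrite (circ_0 s).
Qed.

Lemma cauchy_formula r k k1 s z :
  holo r k k1 -> 0 < s < r -> Cmod z < s ->
  Cint (fun u => (k (circ s u) * circ s u / (circ s u - z))%C)
    = (RtoC (2 * PI) * k z)%C.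
Proof.
  intros Hk Hs Hz.
  set (b := (r - s) / (4 * s)).
  assert (b0 : 0 < b) by (unfold b; apply Rdiv_lt_0_compat; lra).
  assert (Ht : forall t u, - b < t < 1 + b ->
    Cmod (z + RtoC t * (circ s u - z)) < r).
  { intros t u Ht. apply segment_overshoot with s; auto; [lra|]. rewrite Cmod_circ; lra. }
  assert (N : forall u, (circ s u - z)%C <> 0%C) by (intros; apply circ_neq; lra).
  transitivity (Cint (fun u =>
    k (z + RtoC 1 * (circ s u - z)) * (circ s u / (circ s u - z)))%C).
  { apply Cint_ext; intros u. replace (z + 1 * (circ s u - z))%C with (circ s u) by cring.
    cfield; auto. }
  rewrite <- (Cint_homotopy
    (fun t u => k (z + RtoC t * (circ s u - z)) * (circ s u / (circ s u - z)))%C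
    (fun t u => k1 (z + RtoC t * (circ s u - z)) * circ s u)%C (-b) (1 + b)); try lra.
  - rewrite (Cint_ext _ (fun u => k z * (circ s u / (circ s u - z)))%C).
    + rewrite Cint_scal, kernel_integral by
        (first [lra | apply rcont_div; [apply rcont_circ|apply rcont_circ_minus|exact N]]).
      cring.
    + intros u. do 2 f_equal. cring.
  - intros t u Htb. eapply rdiff_eq.
    + apply rdiff_mult; [|apply rdiff_const].
      apply (cdiff_rdiff_comp k); [apply rdiff_affine|now apply Hk, Ht].
    + cfield; auto.
  - intros t u Htb.
    apply (continuous_Cmult (fun p : R * R => k1 (z + RtoC (fst p) * (circ s (snd p) - z)))%C
       (fun p : R * R => circ s (snd p))).
    + apply (continuous_comp (fun p : R * R => (z + RtoC (fst p) * (circ s (snd p) - z)))%C k1).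
      * apply continuous_Cplus; [apply continuous_const|apply continuous_Cmult].
        -- apply continuous_RtoC, continuous_fst.
        -- apply continuous_Cminus; [|apply continuous_const].
           apply (continuous_comp snd (circ s)); [apply continuous_snd|apply continuous_circ].
      * now apply Hk, Ht.
    + apply (continuous_comp snd (circ s)); [apply continuous_snd|apply continuous_circ].
  - intros t Htb. apply rcont_mult.
    + intros u. eapply rdiff_continuous, (cdiff_rdiff_comp k);
        [apply rdiff_circ_affine|now apply Hk, Ht].
    + apply rcont_div; auto; [apply rcont_circ|apply rcont_circ_minus].
  - intros t Htb.
    assert (rc : rcont (fun u => k1 (z + RtoC t * (circ s u - z)) * circ s u)%C).
    { apply rcont_mult; [|apply rcont_circ]. intros u.
      apply (continuous_comp (fun u => z + RtoC t * (circ s u - z))%C k1).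
      - eapply rdiff_continuous, rdiff_circ_affine.
      - now apply Hk, Ht. }
    destruct (Req_dec t 0) as [T|T].
    + apply (Cint_derive_periodic (fun u => k1 z * / Ci * circ s u)%C); auto.
      * intros u. eapply rdiff_eq.
        -- apply rdiff_mult; [apply rdiff_const|apply rdiff_circ].
        -- rewrite T. replace (z + 0 * (circ s u - z))%C with z by cring.
           cfield. apply Ci_neq0.
      * now rewrite (circ_0 s).
    + apply (Cint_derive_periodic
        (fun u => / (RtoC t * Ci) * k (z + RtoC t * (circ s u - z)))%C); auto.
      * intros u. eapply rdiff_eq.
        -- apply rdiff_mult; [apply rdiff_const|].
           apply (cdiff_rdiff_comp k); [apply rdiff_circ_affine|now apply Hk, Ht].
        -- cfield. split; [apply Ci_neq0|now apply RtoC_neq0].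
      * now rewrite (circ_0 s).
Qed.

Lemma rcont_bounded f :
  rcont f -> exists M, 0 <= M /\ forall t, 0 <= t <= 2 * PI -> Cmod (f t) <= M.
Proof.
  intros Hf. pose proof two_PI_pos.
  destruct (continuity_ab_maj (fun t => Cmod (f t)) 0 (2 * PI)) as [m [Hm _]]; [lra| |].
  - intros t _. apply continuity_pt_filterlim. now apply (continuous_Cmod f t).
  - exists (Cmod (f m)). split; [apply Cmod_ge_0|auto].
Qed.

Lemma Cint_continuous (K : C -> R -> C) (z : C) (M : R) :
  locally z (fun w => rcont (K w) /\
    forall t, 0 <= t <= 2 * PI -> Cmod (K w t - K z t) <= M * Cmod (w - z)) ->
  continuous (fun w => Cint (K w)) z.
Proof.
  intros H. destruct (locally_singleton _ _ H) as [Cz _].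
  apply filterlim_locally. intros eps.
  assert (L : locally z (fun w : C => 4 * PI * (M * Cmod (w - z)) < eps)).
  { apply (locally_lt (fun w : C => 4 * PI * (M * Cmod (w - z)))).
    - apply continuous_Rmult; [apply continuous_const|].
      apply continuous_Rmult; [apply continuous_const|].
      apply continuous_Cmod, continuous_Cminus; [apply continuous_id|apply continuous_const].
    - replace (z - z)%C with (RtoC 0) by cring. rewrite Cmod_0, !Rmult_0_r. apply cond_pos. }
  generalize (filter_and _ _ H L); apply filter_imp. intros w [[Cw Hw] Lw].
  apply C_NormedModule_mixin_compat1.
  change (minus (Cint (K w)) (Cint (K z))) with (Cint (K w) - Cint (K z))%C.
  rewrite <- Cint_minus by auto.
  eapply Rle_lt_trans; [|exact Lw].
  apply Cint_bound; auto. now apply rcont_minus.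
Qed.

Definition T1 (s : R) (phi : R -> C) (z : C) : C :=
  Cint (fun u => (phi u / (circ s u - z))%C).
Definition T2 (s : R) (phi : R -> C) (z : C) : C :=
  Cint (fun u => (phi u / ((circ s u - z) * (circ s u - z)))%C).

Lemma circ_far s e t w : 0 < s -> Cmod w < s - e -> e <= Cmod (circ s t - w).
Proof.
  intros Hs Hw. pose proof (Cmod_triangle (circ s t - w) w) as T.
  replace (circ s t - w + w)%C with (circ s t) in T by ring.
  rewrite Cmod_circ in T; lra.
Qed.

Lemma circ_near s t w : 0 < s -> Cmod w < s -> Cmod (circ s t - w) <= 2 * s.
Proof.
  intros Hs Hw. pose proof (Cmod_triangle (circ s t) (- w)) as T.
  rewrite Cmod_opp, Cmod_circ in T by lra. unfold Cminus. lra.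
Qed.

Lemma T1_continuous s phi z :
  0 < s -> rcont phi -> Cmod z < s -> continuous (T1 s phi) z.
Proof.
  intros Hs Hp Hz. destruct (rcont_bounded phi Hp) as [M [M0 HM]].
  set (e := (s - Cmod z) / 2).
  apply (Cint_continuous (fun w u => phi u / (circ s u - w))%C z (M * (/ e * / e))).
  assert (L : locally z (fun w => Cmod w < s - e)) by (apply locally_disc; unfold e; lra).
  revert L; apply filter_imp. intros w Hw.
  assert (e0 : 0 < e) by (unfold e; lra).
  assert (N : forall u, (circ s u - w)%C <> 0%C) by (intros; apply circ_neq; lra).
  assert (Nz : forall u, (circ s u - z)%C <> 0%C) by (intros; apply circ_neq; lra).
  split; [now apply rcont_div; [|apply rcont_circ_minus|]|].
  intros t Ht. change C in w.
  replace (phi t / (circ s t - w) - phi t / (circ s t - z))%C with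
    (phi t * (/ (circ s t - w) * / (circ s t - z)) * (w - z))%C by (field; split; auto).
  rewrite !Cmod_mult, !Cmod_inv by auto.
  pose proof (circ_far s e t w Hs Hw).
  assert (e <= Cmod (circ s t - z)) by (apply circ_far; auto; unfold e; lra).
  apply Rmult_le_compat_r; [apply Cmod_ge_0|].
  apply Rmult_le_compat; [apply Cmod_ge_0| |now apply HM|].
  - apply Rmult_le_pos; apply Rlt_le, Rinv_0_lt_compat; lra.
  - apply Rmult_le_compat; try (apply Rlt_le, Rinv_0_lt_compat; lra);
      apply Rinv_le_contravar; lra.
Qed.

Lemma T2_continuous s phi z :
  0 < s -> rcont phi -> Cmod z < s -> continuous (T2 s phi) z.
Proof.
  intros Hs Hp Hz. destruct (rcont_bounded phi Hp) as [M [M0 HM]].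
  set (e := (s - Cmod z) / 2).
  apply (Cint_continuous (fun w u => phi u / ((circ s u - w) * (circ s u - w)))%C z
    (M * (4 * s * (/ e * / e * (/ e * / e))))).
  assert (L : locally z (fun w => Cmod w < s - e)) by (apply locally_disc; unfold e; lra).
  revert L; apply filter_imp. intros w Hw.
  assert (e0 : 0 < e) by (unfold e; lra).
  assert (N : forall u, (circ s u - w)%C <> 0%C) by (intros; apply circ_neq; lra).
  assert (Nz : forall u, (circ s u - z)%C <> 0%C) by (intros; apply circ_neq; lra).
  split.
  { apply rcont_div; auto; [apply rcont_mult; apply rcont_circ_minus|].
    intros; now apply Cmult_neq_0. }
  intros t Ht. change C in w.
  replace (phi t / ((circ s t - w) * (circ s t - w))
      - phi t / ((circ s t - z) * (circ s t - z)))%C with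
    (phi t * (((circ s t - w) + (circ s t - z)) *
      (/ (circ s t - w) * / (circ s t - w) * (/ (circ s t - z) * / (circ s t - z)))) * (w - z))%C
    by (field; split; auto).
  rewrite !Cmod_mult, !Cmod_inv by auto.
  pose proof (circ_far s e t w Hs Hw).
  assert (e <= Cmod (circ s t - z)) by (apply circ_far; auto; unfold e; lra).
  assert (P : forall x, e <= x -> 0 <= / x <= / e).
  { intros x Hx; split; [apply Rlt_le, Rinv_0_lt_compat; lra|apply Rinv_le_contravar; lra]. }
  pose proof (P _ H). pose proof (P _ H0).
  assert (Q : forall x y x' y', 0 <= x <= x' -> 0 <= y <= y' -> 0 <= x * y <= x' * y').
  { intros; split; [apply Rmult_le_pos|apply Rmult_le_compat]; lra. }
  apply Rmult_le_compat_r; [apply Cmod_ge_0|].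
  apply Q; [split; [apply Cmod_ge_0|now apply HM]|].
  apply Q; [split; [apply Cmod_ge_0|]|].
  - eapply Rle_trans; [apply Cmod_triangle|].
    assert (Cmod (circ s t - w) <= 2 * s) by (apply circ_near; lra).
    assert (Cmod (circ s t - z) <= 2 * s) by (apply circ_near; lra). lra.
  - apply Q; apply Q; auto.
Qed.

Lemma T1_holo s phi : 0 < s -> rcont phi -> holo s (T1 s phi) (T2 s phi).
Proof.
  intros Hs Hp z Hz. split; [|now apply T2_continuous].
  assert (Nz : forall u, (circ s u - z)%C <> 0%C) by (intros; apply circ_neq; lra).
  assert (Rz : rcont (fun u => phi u / (circ s u - z))%C)
    by (apply rcont_div; auto; apply rcont_circ_minus).
  exists (T1 s (fun u => phi u / (circ s u - z))%C). split; [|split].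
  - now apply T1_continuous.
  - apply Cint_ext; intros u. field; auto.
  - generalize (locally_disc s z Hz); apply filter_imp. intros w Hw. change C in w.
    assert (N : forall u, (circ s u - w)%C <> 0%C) by (intros; apply circ_neq; lra).
    unfold T1. rewrite Cmult_comm, <- Cint_scal, <- Cint_plus; auto.
    + apply Cint_ext; intros u. field; split; auto.
    + apply rcont_mult; [apply rcont_const|].
      apply rcont_div; auto. apply rcont_circ_minus.
    + apply rcont_div; auto. apply rcont_circ_minus.
Qed.

Lemma holo_scal r c k k1 :
  holo r k k1 -> holo r (fun z => (c * k z)%C) (fun z => (c * k1 z)%C).
Proof.
  intros Hk. eapply holo_eq; [| |exact (holo_mult _ _ _ _ _ (holo_const r c) Hk)];
    intros; cring.
Qed.

Lemma two_PI_neq0 : RtoC (2 * PI) <> 0%C.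
Proof. apply RtoC_neq0. pose proof two_PI_pos; lra. Qed.

Lemma cauchy_T1 r k k1 s z :
  holo r k k1 -> 0 < s < r -> Cmod z < s ->
  k z = (/ RtoC (2 * PI) * T1 s (fun u => k (circ s u) * circ s u)%C z)%C.
Proof.
  intros Hk Hs Hz. unfold T1. rewrite (cauchy_formula r k k1 s z) by auto.
  field. apply two_PI_neq0.
Qed.

Lemma cauchy_T2 r k k1 s z :
  holo r k k1 -> 0 < s < r -> Cmod z < s ->
  k1 z = (/ RtoC (2 * PI) * T2 s (fun u => k (circ s u) * circ s u)%C z)%C.
Proof.
  intros Hk Hs Hz.
  assert (Hz' : Cmod z < r) by lra.
  apply (cdiff_unique k z); [now apply Hk|].
  apply (cdiff_ext_loc
    (fun z => / RtoC (2 * PI) * T1 s (fun u => k (circ s u) * circ s u)%C z)%C).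
  - generalize (locally_disc s z Hz); apply filter_imp. intros w Hw.
    symmetry. now apply (cauchy_T1 r k k1).
  - assert (rc : rcont (fun u => k (circ s u) * circ s u)%C).
    { apply rcont_mult; [apply (rcont_circ_comp r k k1); auto; lra|apply rcont_circ]. }
    apply (holo_scal s _ _ _ (T1_holo s _ (proj1 Hs) rc)); auto.
Qed.

(* Integration by parts: the Cauchy formula for [k] yields that for [k1]. *)
Lemma cauchy_deriv_T1 r k k1 s z :
  holo r k k1 -> 0 < s < r -> Cmod z < s ->
  k1 z = (/ RtoC (2 * PI) * T1 s (fun u => k1 (circ s u) * circ s u)%C z)%C.
Proof.
  intros Hk Hs Hz. rewrite (cauchy_T2 r k k1 s z) by auto. f_equal.
  assert (Hc : forall u, Cmod (circ s u) < r) by (intros; rewrite Cmod_circ; lra).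
  assert (N : forall u, (circ s u - z)%C <> 0%C) by (intros; apply circ_neq; lra).
  assert (rk1 : rcont (fun u => k1 (circ s u))).
  { intros u. apply (continuous_comp (circ s) k1); [apply continuous_circ|now apply Hk]. }
  assert (rk : rcont (fun u => k (circ s u))) by (apply (rcont_circ_comp r k k1); auto; lra).
  assert (R1 : rcont (fun u => k1 (circ s u) * circ s u / (circ s u - z))%C).
  { apply rcont_div; auto; [|apply rcont_circ_minus].
    apply rcont_mult; auto; apply rcont_circ. }
  assert (R2 : rcont (fun u => k (circ s u) * circ s u / ((circ s u - z) * (circ s u - z)))%C).
  { apply rcont_div.
    - apply rcont_mult; auto; apply rcont_circ.
    - apply rcont_mult; apply rcont_circ_minus.
    - intros; now apply Cmult_neq_0. }
  assert (E : (T1 s (fun u => k1 (circ s u) * circ s u)%C z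
    - T2 s (fun u => k (circ s u) * circ s u)%C z)%C = 0%C).
  { unfold T1, T2. rewrite <- Cint_minus by auto.
    apply (Cint_derive_periodic (fun u => / Ci * (k (circ s u) * / (circ s u - z)))%C).
    - intros u. eapply rdiff_eq.
      + apply rdiff_mult; [apply rdiff_const|].
        apply rdiff_mult.
        * apply (cdiff_rdiff_comp k); [apply rdiff_circ|now apply Hk].
        * apply (cdiff_rdiff_comp (fun w => / w)%C (fun u => circ s u - z)%C).
          -- apply rdiff_plus; [apply rdiff_circ|apply rdiff_const].
          -- apply (cdiff_inv (fun w => w)); [apply cdiff_id|auto].
      + cfield. split; [auto|apply Ci_neq0].
    - now apply rcont_minus.
    - now rewrite (circ_0 s). }
  transitivity (T2 s (fun u => k (circ s u) * circ s u)%C z +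
    (T1 s (fun u => k1 (circ s u) * circ s u)%C z
    - T2 s (fun u => k (circ s u) * circ s u)%C z))%C; [rewrite E|]; ring.
Qed.

Lemma holo_deriv r k k1 s :
  holo r k k1 -> 0 < s < r -> exists k2, holo s k1 k2.
Proof.
  intros Hk Hs.
  assert (rc : rcont (fun u => k1 (circ s u) * circ s u)%C).
  { apply rcont_mult; [|apply rcont_circ]. intros u.
    apply (continuous_comp (circ s) k1); [apply continuous_circ|].
    apply Hk. rewrite Cmod_circ; lra. }
  eexists. eapply holo_eq;
    [| |exact (holo_scal s (/ RtoC (2 * PI)) _ _ (T1_holo s _ (proj1 Hs) rc))].
  - intros z Hz. symmetry. now apply (cauchy_deriv_T1 r k k1).
  - reflexivity.
Qed.

Lemma holo_divide r k k1 s a :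
  holo r k k1 -> 0 < s < r -> Cmod a < s -> k a = 0%C ->
  exists l l1, holo s l l1 /\ forall z, Cmod z < s -> k z = ((z - a) * l z)%C.
Proof.
  intros Hk Hs Ha K0.
  set (phi := fun u => (k (circ s u) * circ s u)%C).
  assert (N : forall w u, Cmod w < s -> (circ s u - w)%C <> 0%C)
    by (intros; apply circ_neq; lra).
  assert (rc : rcont phi).
  { apply rcont_mult; [apply (rcont_circ_comp r k k1); auto; lra|apply rcont_circ]. }
  assert (rd : forall w, Cmod w < s -> rcont (fun u => phi u / (circ s u - w))%C).
  { intros; apply rcont_div; auto. apply rcont_circ_minus. }
  exists (fun z => / RtoC (2 * PI) * T1 s (fun u => phi u / (circ s u - a))%C z)%C.
  eexists; split; [apply holo_scal, T1_holo; [lra|auto]|].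
  intros z Hz.
  replace (k z) with (k z - k a)%C by (rewrite K0; ring).
  rewrite (cauchy_T1 r k k1 s z), (cauchy_T1 r k k1 s a) by auto. fold phi.
  transitivity (/ RtoC (2 * PI) * (T1 s phi z - T1 s phi a))%C; [ring|].
  transitivity (/ RtoC (2 * PI) * ((z - a) * T1 s (fun u => phi u / (circ s u - a))%C z))%C;
    [|ring].
  f_equal. unfold T1. rewrite <- Cint_minus, <- Cint_scal; auto.
  - apply Cint_ext; intros u. field; split; auto.
  - apply rcont_div; auto. apply rcont_circ_minus.
Qed.

Lemma power_bounded_le_1 x B : 0 <= x -> (forall n, x ^ n <= B) -> x <= 1.
Proof.
  intros Hx H. destruct (Rle_lt_dec x 1) as [|L]; auto. exfalso.
  destruct (Pow_x_infinity x) with (b := B + 1) as [n Hn]; [rewrite Rabs_pos_eq; lra|].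
  specialize (Hn n (le_n n)). specialize (H n).
  rewrite Rabs_pos_eq in Hn by (apply pow_le; lra). lra.
Qed.

(* The Cauchy formula for all powers of [k] absorbs the constant of a crude estimate. *)
Lemma max_modulus r k k1 z :
  1 < r -> holo r k k1 -> (forall t, Cmod (k (circ 1 t)) <= 1) ->
  Cmod z < 1 -> Cmod (k z) <= 1.
Proof.
  intros Hr Hk Hb Hz. pose proof two_PI_pos. pose proof (Cmod_ge_0 z).
  apply (power_bounded_le_1 _ (2 * / (1 - Cmod z))); [apply Cmod_ge_0|].
  intros n. destruct (holo_pow r k k1 n Hk) as [l1 Hl].
  pose proof (cauchy_formula r _ _ 1 z Hl ltac:(lra) Hz) as E.
  assert (N : forall u, (circ 1 u - z)%C <> 0%C) by (intros; apply circ_neq; lra).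
  apply (f_equal Cmod) in E. rewrite Cmod_mult, Cmod_R, Rabs_pos_eq, Cmod_pow in E by lra.
  assert (B : Cmod (Cint (fun u => k (circ 1 u) ^ n * circ 1 u / (circ 1 u - z))%C)
     <= 4 * PI * / (1 - Cmod z)).
  { apply Cint_bound.
    - apply rcont_div; auto; [|apply rcont_circ_minus].
      apply rcont_mult; [|apply rcont_circ].
      apply (rcont_circ_comp r _ _ 1 Hl); lra.
    - intros t _. unfold Cdiv. rewrite !Cmod_mult, Cmod_inv, Cmod_circ, Cmod_pow by (auto; lra).
      assert (Cmod (k (circ 1 t)) ^ n <= 1).
      { apply Rle_trans with (1 ^ n); [|rewrite pow1; lra].
        apply pow_incr. split; [apply Cmod_ge_0|auto]. }
      pose proof (pow_le _ n (Cmod_ge_0 (k (circ 1 t)))).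
      assert (1 - Cmod z <= Cmod (circ 1 t - z)).
      { pose proof (Cmod_triangle (circ 1 t - z) z) as T.
        replace (circ 1 t - z + z)%C with (circ 1 t) in T by ring.
        rewrite Cmod_circ in T; lra. }
      assert (/ Cmod (circ 1 t - z) <= / (1 - Cmod z)) by (apply Rinv_le_contravar; lra).
      assert (0 < / Cmod (circ 1 t - z)) by (apply Rinv_0_lt_compat; lra).
      rewrite Rmult_1_r. rewrite <- (Rmult_1_l (/ (1 - Cmod z))).
      apply Rmult_le_compat; lra. }
  rewrite E in B. nra.
Qed.

(** * A Jensen-type inequality at the origin *)

Lemma rdiff_components_ln (x y : R -> R) t dx dy :
  is_derive x t dx -> is_derive y t dy -> 0 < x t ^ 2 + y t ^ 2 ->
  is_derive (fun u => / 2 * ln (x u ^ 2 + y u ^ 2)) t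
    ((x t * dx + y t * dy) / (x t ^ 2 + y t ^ 2)).
Proof.
  intros Hx Hy P. auto_derive.
  - repeat split; try (eexists; eassumption). exact P.
  - replace (Derive (fun u : R => x u) t) with dx by (symmetry; now apply is_derive_unique).
    replace (Derive (fun u : R => y u) t) with dy by (symmetry; now apply is_derive_unique).
    field. simpl in P. lra.
Qed.

Lemma ln_Cmod z : ln (Cmod z) = / 2 * ln (fst z ^ 2 + snd z ^ 2).
Proof.
  unfold Cmod. set (x := fst z ^ 2 + snd z ^ 2).
  assert (H : 0 <= x) by (unfold x; pose proof (pow2_ge_0 (fst z)); pose proof (pow2_ge_0 (snd z)); lra).
  destruct (Rle_lt_or_eq_dec 0 x H) as [P|<-].
  - rewrite <- (sqrt_sqrt x) at 2 by lra. rewrite ln_mult by now apply sqrt_lt_R0. lra.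
  - rewrite sqrt_0. assert (ln 0 = 0) as ->; [|ring].
    unfold ln. destruct (Rlt_dec 0 0); [exfalso; lra|reflexivity].
Qed.

Lemma is_derive_ln_Cmod g t d :
  rdiff g t d -> g t <> 0%C ->
  is_derive (fun u => ln (Cmod (g u))) t (fst (d / g t)%C).
Proof.
  intros [H1 H2] N. pose proof (normsq_pos _ N) as P.
  apply (is_derive_ext (fun u => / 2 * ln (fst (g u) ^ 2 + snd (g u) ^ 2))).
  - intros u. now rewrite ln_Cmod.
  - replace (fst (d / g t)%C) with
      ((fst (g t) * fst d + snd (g t) * snd d) / (fst (g t) ^ 2 + snd (g t) ^ 2)).
    + now apply (rdiff_components_ln (fun u => fst (g u)) (fun u => snd (g u))).
    + simpl. simpl in P. field. lra.
Qed.

Lemma holo_dilate r r' c k k1 :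
  (forall z, Cmod z < r' -> Cmod (c * z) < r) -> holo r k k1 ->
  holo r' (fun z => k (c * z)%C) (fun z => (c * k1 (c * z))%C).
Proof.
  intros H Hk z Hz. specialize (Hk _ (H z Hz)).
  assert (L : cdiff (fun z => (c * z)%C) z c).
  { eapply cdiff_eq; [apply cdiff_mult; [apply cdiff_const|apply cdiff_id]|cring]. }
  split.
  - eapply cdiff_eq; [apply (cdiff_comp k); [exact L|apply Hk]|ring].
  - apply continuous_Cmult; [apply continuous_const|].
    apply (continuous_comp (fun z => (c * z)%C) k1); [|apply Hk].
    now apply cdiff_continuous in L.
Qed.

Lemma mean_value r k k1 s :
  holo r k k1 -> 0 < s < r ->
  Cint (fun u => k (circ s u)) = (RtoC (2 * PI) * k (RtoC 0))%C.
Proof.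
  intros Hk Hs. rewrite <- (cauchy_formula r k k1 s) by (auto; rewrite Cmod_0; lra).
  apply Cint_ext; intros u. field.
  replace (circ s u - 0)%C with (circ s u) by ring. apply circ_neq0; lra.
Qed.

Lemma holo_log_deriv r k k1 k2 :
  holo r k k1 -> holo r k1 k2 -> (forall z, Cmod z < r -> k z <> 0%C) ->
  holo r (fun z => (k1 z * / k z)%C)
    (fun z => (k2 z * / k z + k1 z * (- k1 z / (k z * k z)))%C).
Proof. intros Hk Hk1 N. apply holo_mult; auto. now apply holo_inv. Qed.

Lemma mean_ln_Cmod r k k1 k2 s :
  holo r k k1 -> holo r k1 k2 -> (forall z, Cmod z < r -> k z <> 0%C) -> 0 < s < r ->
  RInt (fun u => ln (Cmod (k (circ s u)))) 0 (2 * PI) = 2 * PI * ln (Cmod (k (RtoC 0))).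
Proof.
  intros Hk Hk1 N Hs.
  set (r' := (r + s) / 2). set (b := (r - r') / (2 * r')).
  assert (Hr' : s < r' < r) by (unfold r'; lra).
  assert (b0 : 0 < b) by (unfold b; apply Rdiv_lt_0_compat; lra).
  assert (Hb : b * r' = (r - r') / 2) by (unfold b; field; lra).
  assert (Ht : forall t z, - b < t < 1 + b -> Cmod z < r' -> Cmod (RtoC t * z) < r).
  { intros t z Ht Hz. rewrite Cmod_mult, Cmod_R.
    assert (Rabs t < 1 + b) by (apply Rabs_def1; lra).
    pose proof (Cmod_ge_0 z).
    assert (Rabs t * Cmod z <= (1 + b) * Cmod z) by (apply Rmult_le_compat_r; lra).
    nra. }
  assert (Hc : forall t u, - b < t < 1 + b -> Cmod (RtoC t * circ s u) < r)
    by (intros; apply Ht; auto; rewrite Cmod_circ; lra).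
  set (q := fun z => (k1 z * / k z)%C).
  assert (Hq := holo_log_deriv r k k1 k2 Hk Hk1 N). fold q in Hq.
  assert (Cq : forall z, Cmod z < r -> continuous q z)
    by (intros z Hz; eapply holo_continuous; eauto).
  transitivity (RInt (fun u => ln (Cmod (k (RtoC 1 * circ s u)%C))) 0 (2 * PI)).
  { apply RInt_ext; intros. now rewrite Cmult_1_l. }
  rewrite <- (RInt_homotopy (fun t u => ln (Cmod (k (RtoC t * circ s u)%C)))
    (fun t u => fst (circ s u * q (RtoC t * circ s u)%C)%C) (- b) (1 + b)); try lra.
  - transitivity (RInt (fun _ => ln (Cmod (k (RtoC 0)))) 0 (2 * PI)).
    + apply RInt_ext; intros. now rewrite Cmult_0_l.
    + rewrite RInt_const. unfold scal; simpl; unfold mult; simpl. ring.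
  - intros t u Htb.
    replace (fst (circ s u * q (RtoC t * circ s u)%C)%C)
      with (fst (k1 (RtoC t * circ s u)%C * circ s u / k (RtoC t * circ s u)%C)%C).
    + apply (is_derive_ln_Cmod (fun x => k (RtoC x * circ s u)%C)); auto.
      apply (cdiff_rdiff_comp k (fun x => RtoC x * circ s u)%C); [|now apply Hk, Hc].
      apply (rdiff_ext (fun x => RtoC 0 + RtoC x * circ s u)%C); [intros; ring|].
      apply rdiff_affine.
    + f_equal. unfold q. field. auto.
  - intros t u Htb.
    assert (c2 : continuous (fun p : R * R => circ s (snd p)) (t, u))
      by (apply (continuous_comp snd (circ s)); [apply continuous_snd|apply continuous_circ]).
    apply (continuous_re (fun p : R * R => circ s (snd p) * q (RtoC (fst p) * circ s (snd p))%C)%C).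
    apply continuous_Cmult; auto.
    apply (continuous_comp (fun p : R * R => (RtoC (fst p) * circ s (snd p)))%C q); auto.
    apply continuous_Cmult; auto. apply continuous_RtoC, continuous_fst.
  - intros t u Htb.
    apply (ex_derive_continuous (V := R_NormedModule) (fun u => ln (Cmod (k (RtoC t * circ s u)%C)))).
    eexists. apply (is_derive_ln_Cmod (fun u => k (RtoC t * circ s u)%C)); auto.
    apply (cdiff_rdiff_comp k (fun u => RtoC t * circ s u)%C); [|now apply Hk, Hc].
    apply rdiff_mult; [apply rdiff_const|apply rdiff_circ].
  - intros t Htb.
    assert (Hd := holo_mult _ _ _ _ _ (holo_id r')
      (holo_dilate r r' (RtoC t) q _ (fun z => Ht t z Htb) Hq)).
    pose proof (mean_value _ _ _ s Hd ltac:(lra)) as E. cbv beta in E.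
    rewrite Cmult_0_l, Cmult_0_r in E.
    exact (f_equal fst E).
Qed.

Lemma fst_scal x z : fst (RtoC x * z)%C = x * fst z.
Proof. simpl; ring. Qed.

Lemma Ci_sin_double s t :
  0 < s -> (Ci * RtoC (sin (2 * t)) =
    (circ s t * circ s t / RtoC (s ^ 2) - RtoC (s ^ 2) / (circ s t * circ s t)) / 2)%C.
Proof.
  intros Hs. set (e := (cos t, sin t) : C). set (d := (cos t, - sin t) : C).
  assert (Ec : circ s t = (RtoC s * e)%C)
    by (apply injective_projections; unfold circ, e; simpl; ring).
  assert (ed : (e * d = 1)%C).
  { apply injective_projections; unfold e, d; simpl; [|ring].
    rewrite <- (sin2_cos2 t). unfold Rsqr; ring. }
  assert (sd : (Ci * RtoC (sin (2 * t)) = (e * e - d * d) / 2)%C).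
  { rewrite sin_2a. unfold e, d.
    apply injective_projections; simpl; field. }
  assert (Ne : e <> 0%C).
  { intros E0. rewrite E0, Cmult_0_l in ed. injection ed; lra. }
  assert (Es : RtoC s <> 0%C) by (apply RtoC_neq0; lra).
  rewrite sd, Ec. replace d with (/ e)%C.
  - replace (RtoC (s ^ 2)) with (RtoC s * RtoC s)%C by (rewrite <- RtoC_mult; f_equal; ring).
    field. auto.
  - transitivity (/ e * (e * d))%C; [rewrite ed; ring|field; auto].
Qed.

Lemma mean_ln_Cmod_cos r k k1 k2 s :
  holo r k k1 -> holo r k1 k2 -> (forall z, Cmod z < r -> k z <> 0%C) -> 0 < s < r ->
  RInt (fun u => ln (Cmod (k (circ s u))) * cos (2 * u)) 0 (2 * PI) =
  PI * s ^ 2 / 2 *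
    fst (k2 (RtoC 0) / k (RtoC 0)
      - (k1 (RtoC 0) / k (RtoC 0)) * (k1 (RtoC 0) / k (RtoC 0)))%C.
Proof.
  intros Hk Hk1 N Hs.
  assert (Hc : forall u, Cmod (circ s u) < r) by (intros; rewrite Cmod_circ; lra).
  set (q := fun z => (k1 z * / k z)%C).
  assert (Hq := holo_log_deriv r k k1 k2 Hk Hk1 N). fold q in Hq.
  assert (rq : rcont (fun u => q (circ s u))) by (eapply rcont_circ_comp; eauto; lra).
  assert (du : forall u, is_derive (fun u => ln (Cmod (k (circ s u)))) u
    (fst (Ci * circ s u * q (circ s u))%C)).
  { intros u. replace (Ci * circ s u * q (circ s u))%C
      with (k1 (circ s u) * (Ci * circ s u) / k (circ s u))%C by (unfold q; field; auto).
    apply (is_derive_ln_Cmod (fun u => k (circ s u))); auto.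
    apply (cdiff_rdiff_comp k); [apply rdiff_circ|now apply Hk]. }
  assert (cu : forall u, continuous (fun u => ln (Cmod (k (circ s u)))) u).
  { intros u. apply (ex_derive_continuous (V := R_NormedModule) (fun u => ln (Cmod (k (circ s u))))).
    eexists; apply du. }
  assert (ccos : forall u, continuous (fun u => cos (2 * u)) u).
  { intros u. apply (ex_derive_continuous (V := R_NormedModule) (fun u => cos (2 * u))).
    eexists. auto_derive; auto. }
  assert (csin : forall u, continuous (fun u => sin (2 * u)) u).
  { intros u. apply (ex_derive_continuous (V := R_NormedModule) (fun u => sin (2 * u))).
    eexists. auto_derive; auto. }
  set (W := fun u => (Ci * circ s u * q (circ s u) * RtoC (sin (2 * u)))%C).
  assert (rW : rcont W).
  { intros u. apply continuous_Cmult; [|now apply continuous_RtoC].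
    apply continuous_Cmult; auto. apply continuous_Cmult; [apply continuous_const|apply continuous_circ]. }
  assert (P : RInt (fun u => 2 * (ln (Cmod (k (circ s u))) * cos (2 * u)) + 1 * fst (W u)) 0 (2 * PI) = 0).
  { apply (RInt_derive_periodic (fun u => ln (Cmod (k (circ s u))) * sin (2 * u))).
    - intros u.
      replace (2 * (ln (Cmod (k (circ s u))) * cos (2 * u)) + 1 * fst (W u)) with
        (fst (Ci * circ s u * q (circ s u))%C * sin (2 * u)
         + ln (Cmod (k (circ s u))) * (2 * cos (2 * u))).
      + apply (is_derive_mult (K := R_AbsRing) (fun u => ln (Cmod (k (circ s u)))) (fun u => sin (2 * u))).
        * apply du.
        * auto_derive; auto. ring.
        * intros; apply Rmult_comm.
      + unfold W. simpl. ring.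
    - intros u. apply continuous_Rplus; apply continuous_Rmult; try apply continuous_const.
      + now apply continuous_Rmult.
      + now apply continuous_re.
    - rewrite <- circ_0. rewrite Rmult_0_r, sin_0.
      replace (2 * (2 * PI)) with (0 + 2 * INR 2 * PI) by (simpl; ring).
      now rewrite sin_period, sin_0. }
  rewrite RInt_lin in P; [|intros; now apply continuous_Rmult|intros; now apply continuous_re].
  assert (Q : Cint W = (RtoC (- (PI * s ^ 2)) *
     (k2 (RtoC 0) / k (RtoC 0)
      - (k1 (RtoC 0) / k (RtoC 0)) * (k1 (RtoC 0) / k (RtoC 0))))%C).
  { assert (Ns : forall u, circ s u <> 0%C) by (intros; apply circ_neq0; lra).
    assert (Es : RtoC (s ^ 2) <> 0%C) by (apply RtoC_neq0; nra).
    assert (Z : Cmod (RtoC 0) < s) by (rewrite Cmod_0; lra).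
    assert (N0 : k (RtoC 0) <> 0%C) by (apply N; rewrite Cmod_0; lra).
    pose proof (cauchy_T2 r q _ s (RtoC 0) Hq (proj1 (conj Hs I)) Z) as T.
    pose proof (mean_value r _ _ s (holo_mult _ _ _ _ _ (holo_id r)
      (holo_mult _ _ _ _ _ (holo_id r) (holo_mult _ _ _ _ _ (holo_id r) Hq)))
      (proj1 (conj Hs I))) as M.
    cbv beta in M. rewrite Cmult_0_l, Cmult_0_r in M.
    assert (R1 : rcont (fun u => circ s u * (circ s u * (circ s u * q (circ s u))))%C)
      by (do 3 (apply rcont_mult; [apply rcont_circ|]); exact rq).
    assert (R2 : rcont (fun u => q (circ s u) * circ s u / ((circ s u - RtoC 0) * (circ s u - RtoC 0)))%C).
    { apply rcont_div.
      - apply rcont_mult; auto using rcont_circ.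
      - apply rcont_mult; apply rcont_circ_minus.
      - intros u; apply Cmult_neq_0; apply circ_neq; lra. }
    rewrite (Cint_ext W (fun u =>
      (/ (2 * RtoC (s ^ 2)) * (circ s u * (circ s u * (circ s u * q (circ s u))))
       - RtoC (s ^ 2) * / 2 * (q (circ s u) * circ s u / ((circ s u - RtoC 0) * (circ s u - RtoC 0))))%C)).
    - rewrite Cint_minus, !Cint_scal, M by
        (auto; apply rcont_mult; auto; apply rcont_const).
      unfold T2 in T.
      set (X := Cint _) in *.
      replace X with (RtoC (2 * PI) * (/ RtoC (2 * PI) * X))%C
        by (field; apply two_PI_neq0).
      rewrite <- T. rewrite RtoC_opp, !RtoC_mult. field. auto.
    - intros u. unfold W.
      replace (Ci * circ s u * q (circ s u) * RtoC (sin (2 * u)))%C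
        with (circ s u * q (circ s u) * (Ci * RtoC (sin (2 * u))))%C by ring.
      rewrite (Ci_sin_double s u) by lra. field.
      replace (circ s u - RtoC 0)%C with (circ s u) by ring. auto. }
  change (RInt (fun u => fst (W u)) 0 (2 * PI)) with (fst (Cint W)) in P.
  rewrite Q, fst_scal in P. lra.
Qed.

Definition log_second (k k1 k2 : C -> C) : R :=
  fst (k2 (RtoC 0) / k (RtoC 0)
    - (k1 (RtoC 0) / k (RtoC 0)) * (k1 (RtoC 0) / k (RtoC 0)))%C.

Definition jensen (s : R) (k k1 k2 : C -> C) : R :=
  ln (Cmod (k (RtoC 0))) - s ^ 2 / 4 * log_second k k1 k2.

(* [1 - cos (2 u) >= 0], and its integral against [ln |k|] is [2 PI * jensen s k k1 k2]. *)
Lemma jensen_zero_free r k k1 k2 s :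
  holo r k k1 -> holo r k1 k2 -> 0 < s < r ->
  (forall z, Cmod z < r -> k z <> 0%C) ->
  (forall z, Cmod z < r -> Cmod (k z) <= 1) ->
  jensen s k k1 k2 <= 0.
Proof.
  intros Hk Hk1 Hs N Hb. pose proof PI_RGT_0.
  pose proof (mean_ln_Cmod r k k1 k2 s Hk Hk1 N Hs) as A.
  pose proof (mean_ln_Cmod_cos r k k1 k2 s Hk Hk1 N Hs) as B.
  assert (Hc : forall u, Cmod (circ s u) < r) by (intros; rewrite Cmod_circ; lra).
  set (v := fun u => ln (Cmod (k (circ s u)))) in *.
  assert (cv : forall u, continuous v u).
  { intros u. apply (ex_derive_continuous (V := R_NormedModule) v).
    eexists. apply (is_derive_ln_Cmod (fun u => k (circ s u))); auto.
    apply (cdiff_rdiff_comp k); [apply rdiff_circ|now apply Hk]. }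
  assert (cc : forall u, continuous (fun u => v u * cos (2 * u)) u).
  { intros u. apply continuous_Rmult; auto.
    apply (ex_derive_continuous (V := R_NormedModule) (fun u => cos (2 * u))).
    eexists. auto_derive; auto. }
  assert (E : RInt (fun u => 1 * v u + (-1) * (v u * cos (2 * u))) 0 (2 * PI) <= 0).
  { replace 0 with (RInt (fun _ => 0) 0 (2 * PI)) at 2.
    - apply RInt_le; [lra| | |].
      + apply ex_RInt_cont. intros u. apply continuous_Rplus; apply continuous_Rmult; auto;
          apply continuous_const.
      + apply ex_RInt_const.
      + intros u _. pose proof (COS_bound (2 * u)).
        assert (v u <= 0); [|nra].
        unfold v. rewrite <- ln_1. apply ln_le; [now apply Cmod_gt_0, N|now apply Hb].
    - rewrite RInt_const. unfold scal; simpl; unfold mult; simpl. ring. }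
  rewrite RInt_lin in E by auto. rewrite A in E.
  change (RInt (fun u => v u * cos (2 * u)) 0 (2 * PI) =
    PI * s ^ 2 / 2 * log_second k k1 k2) in B.
  rewrite B in E. unfold jensen.
  apply (Rmult_le_reg_l (2 * PI)); lra.
Qed.

Lemma Cmod_sq z : Cmod z ^ 2 = fst z ^ 2 + snd z ^ 2.
Proof. apply Cmod2_alt. Qed.

Lemma circ_blaschke t a : Cmod (1 - Cconj a * circ 1 t) = Cmod (circ 1 t - a).
Proof.
  unfold Cmod; f_equal. unfold circ; simpl.
  pose proof (sin2_cos2 t) as E; unfold Rsqr in E. nra.
Qed.

Lemma one_minus_conj_neq0 a z : Cmod a < 1 -> Cmod z <= 1 -> (1 - Cconj a * z)%C <> 0%C.
Proof.
  intros Ha Hz E. pose proof (Cmod_ge_0 z). pose proof (Cmod_ge_0 a).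
  assert (E1 : (Cconj a * z = 1)%C).
  { replace (Cconj a * z)%C with (1 - (1 - Cconj a * z))%C by ring. rewrite E; ring. }
  apply (f_equal Cmod) in E1. rewrite Cmod_mult, Cmod_conj, Cmod_1 in E1. nra.
Qed.

Lemma blaschke_log_second (a : C) :
  a <> 0%C -> Cmod a < 1 -> fst (a * a)%C <= 0 ->
  0 <= fst (Cconj a * Cconj a - / (a * a))%C.
Proof.
  intros N Ha Hr. pose proof (normsq_pos a N) as P. rewrite <- Cmod_sq in P.
  assert (Q : Cmod a ^ 2 <= 1) by (pose proof (Cmod_ge_0 a); nra).
  set (m := Cmod a ^ 2) in *.
  assert (E : (/ (a * a))%C = (RtoC (/ (m * m)) * (Cconj a * Cconj a))%C).
  { assert (Em : RtoC m = (a * Cconj a)%C) by apply Cmod2_conj.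
    assert (Nm : RtoC m <> 0%C) by (apply RtoC_neq0; lra).
    assert (Nc : Cconj a <> 0%C) by (intros Z; rewrite Em, Z in Nm; apply Nm; ring).
    rewrite RtoC_inv, RtoC_mult, Em by (apply Rmult_integral_contrapositive; lra).
    field. auto. }
  rewrite E.
  replace (fst (Cconj a * Cconj a - RtoC (/ (m * m)) * (Cconj a * Cconj a))%C)
    with ((/ (m * m) - 1) * - fst (a * a)%C) by (simpl; ring).
  assert (1 <= / (m * m)).
  { rewrite <- Rinv_1 at 1. apply Rinv_le_contravar; nra. }
  apply Rmult_le_pos; lra.
Qed.

Definition admissible (r : R) (k k1 k2 : C -> C) : Prop :=
  1 < r /\ holo r k k1 /\ holo r k1 k2 /\
  (forall t, Cmod (k (circ 1 t)) <= 1) /\ k (RtoC 0) <> 0%C /\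
  (forall a : C, Cmod a < 1 -> k a = 0%C -> fst (a * a)%C <= 0).

Lemma holo_unique r k k1 l1 z :
  holo r k k1 -> holo r k l1 -> Cmod z < r -> k1 z = l1 z.
Proof. intros H1 H2 Hz. apply (cdiff_unique k z); [now apply H1|now apply H2]. Qed.

Lemma blaschke_step r k k1 k2 s (a : C) :
  admissible r k k1 k2 -> Cmod a < 1 -> k a = 0%C ->
  exists r' l l1 l2, admissible r' l l1 l2 /\
    (forall z, Cmod z < 1 -> k z * (1 - Cconj a * z) = (z - a) * l z)%C /\
    jensen s k k1 k2 <= ln (Cmod a) + jensen s l l1 l2.
Proof.
  intros (Hr & Hk & Hk1 & Hb & K0 & Hz) Ha Ka.
  set (s1 := (1 + r) / 2). set (s2 := (1 + s1) / 2).
  assert (S : 1 < s2 < s1 /\ s1 < r) by (unfold s2, s1; lra).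
  destruct (holo_divide r k k1 s1 a Hk ltac:(lra) ltac:(lra) Ka) as (m & m1 & Hm & E).
  destruct (holo_deriv s1 m m1 s2 Hm ltac:(lra)) as [m2 Hm1].
  apply (holo_mono s1 s2) in Hm; [|lra].
  assert (Hid : holo s2 (fun z => z - a)%C (fun _ => RtoC 1)).
  { eapply holo_eq; [| |exact (holo_plus _ _ _ _ _ (holo_id s2) (holo_const s2 (- a)%C))];
      intros; cring. }
  assert (Hbl : holo s2 (fun z => 1 - Cconj a * z)%C (fun _ => - Cconj a)%C).
  { eapply holo_eq; [| |exact (holo_plus _ _ _ _ _ (holo_const s2 (RtoC 1))
      (holo_scal s2 (- Cconj a)%C _ _ (holo_id s2)))]; intros; cring. }
  set (l := fun z => ((1 - Cconj a * z) * m z)%C).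
  set (l1 := fun z => (- Cconj a * m z + (1 - Cconj a * z) * m1 z)%C).
  set (l2 := fun z => (- Cconj a * m1 z + (- Cconj a * m1 z + (1 - Cconj a * z) * m2 z))%C).
  assert (Hl : holo s2 l l1) by exact (holo_mult _ _ _ _ _ Hbl Hm).
  assert (Hl1 : holo s2 l1 l2).
  { apply holo_plus; [now apply holo_scal|]. exact (holo_mult _ _ _ _ _ Hbl Hm1). }
  assert (E1 : forall z, Cmod z < s2 -> k1 z = (1 * m z + (z - a) * m1 z)%C).
  { intros z Hzs. apply (holo_unique s2 k k1 (fun z => 1 * m z + (z - a) * m1 z)%C); [eapply holo_mono; [|exact Hk]; lra| |auto].
    eapply holo_eq; [| |exact (holo_mult _ _ _ _ _ Hid Hm)]; auto.
    intros w Hw; cbv beta. rewrite E; [reflexivity|lra]. }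
  assert (E2 : forall z, Cmod z < s2 -> k2 z = (1 * m1 z + (1 * m1 z + (z - a) * m2 z))%C).
  { intros z Hzs. apply (holo_unique s2 k1 k2 (fun z => 1 * m1 z + (1 * m1 z + (z - a) * m2 z))%C); [eapply holo_mono; [|exact Hk1]; lra| |auto].
    eapply holo_eq; [| |exact (holo_plus _ _ _ _ _ (holo_scal s2 (RtoC 1) _ _ Hm)
      (holo_mult _ _ _ _ _ Hid Hm1))]; auto.
    intros w Hw; cbv beta. now rewrite E1. }
  assert (rel : forall z, Cmod z < s1 -> (k z * (1 - Cconj a * z) = (z - a) * l z)%C).
  { intros z Hzs. rewrite E by auto. unfold l. ring. }
  assert (Z0 : Cmod (RtoC 0) < s2) by (rewrite Cmod_0; lra).
  pose proof (E (RtoC 0) ltac:(lra)) as k0E.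
  pose proof (E1 (RtoC 0) Z0) as k1E. pose proof (E2 (RtoC 0) Z0) as k2E.
  assert (Na : a <> 0%C).
  { intros A0. apply K0. now rewrite A0 in Ka. }
  assert (M0 : m (RtoC 0) <> 0%C).
  { intros M. apply K0. rewrite k0E, M. ring. }
  exists s2, l, l1, l2. split; [|split].
  - split; [lra|]. split; [auto|]. split; [auto|]. split; [|split].
    + intros t. specialize (rel (circ 1 t)). rewrite Cmod_circ in rel by lra.
      specialize (rel ltac:(lra)). apply (f_equal Cmod) in rel.
      rewrite !Cmod_mult, circ_blaschke in rel.
      assert (P : 0 < Cmod (circ 1 t - a)) by (apply Cmod_gt_0, circ_neq; lra).
      replace (Cmod (l (circ 1 t))) with (Cmod (k (circ 1 t))); auto.
      apply (Rmult_eq_reg_l (Cmod (circ 1 t - a))); lra.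
    + unfold l. apply Cmult_neq_0; auto.
      apply one_minus_conj_neq0; auto. rewrite Cmod_0; lra.
    + intros z Hzs Lz. apply Hz; auto.
      specialize (rel z ltac:(lra)). rewrite Lz, Cmult_0_r in rel.
      pose proof (one_minus_conj_neq0 a z Ha ltac:(lra)) as B.
      transitivity (k z * (1 - Cconj a * z) / (1 - Cconj a * z))%C; [field; auto|].
      rewrite rel. field; auto.
  - intros z Hzs; apply rel; lra.
  - pose proof (blaschke_log_second a Na Ha (Hz a Ha Ka)) as P.
    assert (EL : log_second k k1 k2 = log_second l l1 l2
       + fst (Cconj a * Cconj a - / (a * a))%C).
    { unfold log_second. rewrite k0E, k1E, k2E. unfold l, l1, l2.
      match goal with |- fst ?x = fst ?y + fst ?z => change (fst x = fst (y + z)%C) end.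
      f_equal. field. repeat split; auto. }
    assert (EC : ln (Cmod (k (RtoC 0))) = ln (Cmod a) + ln (Cmod (l (RtoC 0)))).
    { unfold l. rewrite <- ln_mult.
      - rewrite <- Cmod_mult, k0E, <- Cmod_opp. do 2 f_equal. ring.
      - now apply Cmod_gt_0.
      - apply Cmod_gt_0, Cmult_neq_0; auto.
        apply one_minus_conj_neq0; auto. rewrite Cmod_0; lra. }
    unfold jensen. rewrite EL, EC.
    pose proof (pow2_ge_0 s). nra.
Qed.

Lemma ln_nonpos x : 0 < x <= 1 -> ln x <= 0.
Proof. intros H. rewrite <- ln_1. apply ln_le; lra. Qed.

Lemma jensen_pow s rho n : 0 < s < rho -> rho < 1 ->
  forall r k k1 k2, admissible r k k1 k2 -> rho ^ n < Cmod (k (RtoC 0)) ->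
  jensen s k k1 k2 <= 0.
Proof.
  intros Hs Hrho. induction n as [|n IH]; intros r k k1 k2 A Hn;
    pose proof A as (Hr & Hk & Hk1 & Hb & K0 & Hz);
    assert (Z0 : Cmod (RtoC 0) < 1) by (rewrite Cmod_0; lra).
  - exfalso. pose proof (max_modulus r k k1 _ Hr Hk Hb Z0). simpl in Hn. lra.
  - destruct (classic (exists a, Cmod a < rho /\ k a = 0%C)) as [[a [Ha Ka]]|N].
    + destruct (blaschke_step r k k1 k2 s a A ltac:(lra) Ka)
        as (r' & l & l1 & l2 & Al & rel & J).
      assert (Na : 0 < Cmod a).
      { apply Cmod_gt_0. intros A0. now rewrite A0 in Ka. }
      assert (M : Cmod (k (RtoC 0)) = Cmod a * Cmod (l (RtoC 0))).
      { specialize (rel _ Z0). rewrite <- Cmod_mult, <- (Cmod_opp (a * _)). f_equal.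
        replace (k (RtoC 0)) with (k (RtoC 0) * (1 - Cconj a * RtoC 0))%C by ring.
        rewrite rel. ring. }
      pose proof (Cmod_ge_0 (l (RtoC 0))).
      assert (L : rho ^ n < Cmod (l (RtoC 0))) by (simpl in Hn; nra).
      pose proof (IH r' l l1 l2 Al L).
      pose proof (ln_nonpos (Cmod a) ltac:(lra)). lra.
    + apply (jensen_zero_free rho k k1 k2); auto.
      * apply (holo_mono r); auto; lra.
      * apply (holo_mono r); auto; lra.
      * intros z Hzr Kz. apply N. now exists z.
      * intros z Hzr. apply (max_modulus r k k1); auto; lra.
Qed.

Lemma jensen_nonpos r k k1 k2 s :
  admissible r k k1 k2 -> 0 < s < 1 -> jensen s k k1 k2 <= 0.
Proof.
  intros A Hs. pose proof A as (_ & _ & _ & _ & K0 & _).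
  apply Cmod_gt_0 in K0.
  destruct (pow_lt_1_zero ((1 + s) / 2)) with (y := Cmod (k (RtoC 0))) as [n Hn]; auto.
  { rewrite Rabs_pos_eq; lra. }
  specialize (Hn n (le_n n)). rewrite Rabs_pos_eq in Hn by (apply pow_le; lra).
  apply (jensen_pow s ((1 + s) / 2) n) with r; auto; lra.
Qed.

Lemma jensen_two_zeros r k k1 k2 s (a b : C) :
  admissible r k k1 k2 -> 0 < s < 1 -> Cmod a < 1 -> Cmod b < 1 -> a <> b ->
  k a = 0%C -> k b = 0%C ->
  jensen s k k1 k2 <= ln (Cmod a) + ln (Cmod b).
Proof.
  intros A Hs Ha Hb N Ka Kb.
  destruct (blaschke_step r k k1 k2 s a A Ha Ka) as (r' & l & l1 & l2 & Al & rel & J).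
  assert (Lb : l b = 0%C).
  { specialize (rel b Hb). rewrite Kb, Cmult_0_l in rel.
    assert (Nb : (b - a)%C <> 0%C).
    { intros Z. apply N. replace b with (b - a + a)%C by ring. rewrite Z. ring. }
    transitivity ((b - a) * l b / (b - a))%C; [field; auto|].
    rewrite <- rel. field; auto. }
  destruct (blaschke_step r' l l1 l2 s b Al Hb Lb) as (r2 & m & m1 & m2 & Am & _ & J').
  pose proof (jensen_nonpos r2 m m1 m2 s Am Hs). lra.
Qed.

Lemma log_two_zeros g g1 g2 e (a : C) :
  holo 1 g g1 -> 0 < e -> holo e g1 g2 -> (forall z, Cmod z < 1 -> Cmod (g z) <= 1) ->
  g (RtoC 0) <> 0%C ->
  (forall z : C, Cmod z < 1 -> g z = 0%C -> fst (z * z)%C <= 0) ->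
  Cmod a < 1 -> g a = 0%C -> g (Cconj a) = 0%C -> a <> Cconj a ->
  ln (Cmod (g (RtoC 0))) - / 4 * log_second g g1 g2 <= 2 * ln (Cmod a).
Proof.
  intros Hg He Hg1 Hb G0 Hz Ha Ga Gc Na.
  set (X := ln (Cmod (g (RtoC 0)))). set (Q := log_second g g1 g2).
  assert (A0 : 0 < Cmod a).
  { apply Cmod_gt_0. intros Z. apply Na. rewrite Z.
    apply injective_projections; simpl; ring. }
  assert (T : forall t, Cmod a < t < 1 ->
    X - t ^ 2 / 4 * (t * t * Q) <= 2 * ln (Cmod a) - 2 * ln t).
  { intros t Ht.
    assert (tn : RtoC t <> 0%C) by (apply RtoC_neq0; lra).
    set (r := (1 + / t) / 2).
    assert (It : 1 < / t) by (rewrite <- Rinv_1; apply Rinv_lt_contravar; lra).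
    assert (Hr : 1 < r < / t) by (unfold r; lra).
    assert (rt : t * r < 1).
    { rewrite <- (Rinv_r t) by lra. apply Rmult_lt_compat_l; lra. }
    set (s := (1 + t * r) / 2).
    assert (Hs : t * r < s < 1) by (unfold s; lra).
    destruct (holo_deriv 1 g g1 s Hg ltac:(nra)) as [h2 Hh2].
    assert (E2 : h2 (RtoC 0) = g2 (RtoC 0)).
    { apply (cdiff_unique g1 (RtoC 0)); [apply Hh2|apply Hg1]; rewrite Cmod_0; nra. }
    assert (M : forall z, Cmod z < r -> Cmod (RtoC t * z) < t * r).
    { intros z Hzr. rewrite Cmod_mult, Cmod_R, Rabs_pos_eq by lra.
      apply Rmult_lt_compat_l; lra. }
    assert (HM1 : forall z, Cmod z < r -> Cmod (RtoC t * z) < 1)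
      by (intros z Hzr; specialize (M z Hzr); lra).
    assert (HM2 : forall z, Cmod z < r -> Cmod (RtoC t * z) < s)
      by (intros z Hzr; specialize (M z Hzr); lra).
    set (k := fun z => g (RtoC t * z)%C).
    set (k1 := fun z => (RtoC t * g1 (RtoC t * z))%C).
    set (k2 := fun z => (RtoC t * (RtoC t * h2 (RtoC t * z)))%C).
    assert (Ad : admissible r k k1 k2).
    { split; [lra|]. split; [|split; [|split; [|split]]].
      - exact (holo_dilate 1 r (RtoC t) g g1 HM1 Hg).
      - apply holo_scal. exact (holo_dilate s r (RtoC t) g1 h2 HM2 Hh2).
      - intros u. apply Hb, HM1. rewrite Cmod_circ; lra.
      - unfold k. now rewrite Cmult_0_r.
      - intros z Hz1 Kz. specialize (Hz _ (HM1 z ltac:(lra)) Kz).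
        replace (fst (RtoC t * z * (RtoC t * z))%C) with (t * t * fst (z * z)%C) in Hz
          by (simpl; ring).
        assert (0 < t * t) by nra. nra. }
    assert (Mi : forall z, Cmod (z / RtoC t) = Cmod z / t).
    { intros z. rewrite Cmod_div, Cmod_R, Rabs_pos_eq by (auto; lra). reflexivity. }
    assert (Lt : Cmod a / t < 1).
    { apply (Rmult_lt_reg_r t); [lra|]. unfold Rdiv. rewrite Rmult_assoc, Rinv_l; lra. }
    pose proof (jensen_two_zeros r k k1 k2 t (a / RtoC t) (Cconj a / RtoC t) Ad) as J.
    rewrite !Mi, Cmod_conj in J.
    assert (K : forall z, k (z / RtoC t)%C = g z).
    { intros z. unfold k. f_equal. field; auto. }
    rewrite !K in J.
    specialize (J ltac:(lra) Lt Lt).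
    assert (Nt : (a / RtoC t)%C <> (Cconj a / RtoC t)%C).
    { intros E. apply Na. transitivity (a / RtoC t * RtoC t)%C; [field; auto|].
      rewrite E. field; auto. }
    specialize (J Nt Ga Gc).
    unfold Rdiv in J at 1 2. rewrite ln_mult, ln_Rinv in J by (try apply Rinv_0_lt_compat; lra).
    unfold jensen in J.
    assert (EQ : log_second k k1 k2 = t * t * Q).
    { unfold Q, log_second, k, k1, k2. rewrite Cmult_0_r, E2.
      rewrite <- fst_scal, RtoC_mult. f_equal. field. auto. }
    rewrite EQ in J. unfold k in J. rewrite Cmult_0_r in J. fold X in J.
    lra. }
  apply Rnot_lt_le. intros L.
  set (h := fun t => X - t ^ 2 / 4 * (t * t * Q) - 2 * ln (Cmod a) + 2 * ln t).
  assert (C : continuous h 1).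
  { apply (ex_derive_continuous (V := R_NormedModule) h). unfold h.
    auto_derive. lra. }
  assert (P : 0 < h 1) by (unfold h; rewrite ln_1; lra).
  destruct (C (fun y => 0 < y) (open_gt 0 _ P)) as [d Hd].
  set (t := Rmax (1 - d / 2) ((1 + Cmod a) / 2)).
  pose proof (cond_pos d).
  assert (Ht : Cmod a < t < 1).
  { unfold t; split.
    - eapply Rlt_le_trans; [|apply Rmax_r]; lra.
    - apply Rmax_lub_lt; lra. }
  specialize (T t Ht).
  assert (B : 0 < h t).
  { apply Hd. unfold ball; simpl; unfold AbsRing_ball, abs, minus, plus, opp; simpl.
    assert (1 - d / 2 <= t) by apply Rmax_l.
    rewrite Rabs_left; lra. }
  unfold h in B. lra.
Qed.

(** * Second derivatives of [ln |g|] along lines *)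

Lemma Derive_ln_Cmod_line g g1 g2 e (c : C) :
  0 < e -> holo e g g1 -> holo e g1 g2 -> g (RtoC 0) <> 0%C ->
  Derive_n (fun t => ln (Cmod (g (RtoC t * c)%C))) 2 0 =
  fst (c * c * (g2 (RtoC 0) / g (RtoC 0)
    - (g1 (RtoC 0) / g (RtoC 0)) * (g1 (RtoC 0) / g (RtoC 0))))%C.
Proof.
  intros He Hg Hg1 G0.
  set (line := fun t => (RtoC t * c)%C).
  assert (Dl : forall t, rdiff line t c).
  { intros t. apply (rdiff_ext (fun t => RtoC 0 + RtoC t * c)%C); [intros; unfold line; ring|].
    apply rdiff_affine. }
  assert (l0 : line 0 = RtoC 0) by (unfold line; ring).
  assert (Cl : continuous line 0) by (eapply rdiff_continuous, Dl).
  assert (Z0 : Cmod (line 0) < e) by (rewrite l0, Cmod_0; lra).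
  assert (L : locally 0 (fun t => Cmod (line t) < e /\ g (line t) <> 0%C)).
  { apply filter_and.
    - exact (Cl _ (locally_disc e _ Z0)).
    - apply (Cl (fun z => g z <> 0%C)). apply locally_neq0; [|now rewrite l0].
      eapply holo_continuous; eauto. }
  set (h := fun t => fst (g1 (line t) * c / g (line t))%C).
  simpl. rewrite (Derive_ext_loc _ h).
  - apply is_derive_unique. unfold h.
    assert (H : rdiff (fun t => g1 (line t) * c * / g (line t))%C 0
      (c * c * (g2 (RtoC 0) / g (RtoC 0)
    - (g1 (RtoC 0) / g (RtoC 0)) * (g1 (RtoC 0) / g (RtoC 0))))%C).
    { eapply rdiff_eq.
      - apply rdiff_mult.
        + apply rdiff_mult; [|apply rdiff_const].
          apply (cdiff_rdiff_comp g1); [apply Dl|now apply Hg1].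
        + apply (cdiff_rdiff_comp (fun z => / g z)%C); [apply Dl|].
          apply cdiff_inv; [now apply Hg|now rewrite l0].
      - cbv beta. rewrite l0. cfield. auto. }
    exact (proj1 H).
  - revert L; apply filter_imp. intros t [Ht Nt]. apply is_derive_unique.
    apply (is_derive_ln_Cmod (fun t => g (line t))); auto.
    apply (cdiff_rdiff_comp g); [apply Dl|now apply Hg].
Qed.

(** * The complex function behind the symmetrization *)

Lemma is_derive_fst {V W : NormedModule R_AbsRing} (f : R -> V * W) (x : R) (l : V * W) :
  is_derive f x l -> is_derive (fun t => fst (f t)) x (fst l).
Proof.
  intros H. unfold is_derive in *.
  eapply filterdiff_ext_lin.
  - apply (filterdiff_comp' f fst); [exact H|].
    apply filterdiff_linear, is_linear_fst.
  - intros y. reflexivity.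
Qed.

Lemma is_derive_snd {V W : NormedModule R_AbsRing} (f : R -> V * W) (x : R) (l : V * W) :
  is_derive f x l -> is_derive (fun t => snd (f t)) x (snd l).
Proof.
  intros H. unfold is_derive in *.
  eapply filterdiff_ext_lin.
  - apply (filterdiff_comp' f snd); [exact H|].
    apply filterdiff_linear, is_linear_snd.
  - intros y. reflexivity.
Qed.

Lemma continuous_fst_comp {U V W : UniformSpace} (f : U -> V * W) x :
  continuous f x -> continuous (fun y => fst (f y)) x.
Proof.
  intros H. apply (continuous_comp f fst); [exact H|].
  destruct (f x); apply continuous_fst.
Qed.

Lemma continuous_snd_comp {U V W : UniformSpace} (f : U -> V * W) x :
  continuous f x -> continuous (fun y => snd (f y)) x.
Proof.
  intros H. apply (continuous_comp f snd); [exact H|].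
  destruct (f x); apply continuous_snd.
Qed.

Lemma cdiff_little_o (k : C -> C) (z d : C) :
  (forall eps : posreal, locally z (fun w =>
     Cmod (k w - k z - d * (w - z)) <= eps * Cmod (w - z))) ->
  cdiff k z d.
Proof.
  intros H.
  exists (fun w => if Ceq_dec w z then d else ((k w - k z) / (w - z))%C).
  assert (E0 : (if Ceq_dec z z then d else ((k z - k z) / (z - z))%C) = d)
    by (destruct (Ceq_dec z z); congruence).
  split; [|split; [exact E0|]].
  - apply filterlim_locally. intros eps. rewrite E0.
    specialize (H (mkposreal (eps / 2) ltac:(destruct eps; simpl; lra))).
    revert H; apply filter_imp. intros w Hw. simpl in Hw.
    destruct (Ceq_dec w z) as [_|N]; [apply ball_center|].
    apply C_NormedModule_mixin_compat1.
    change (minus ((k w - k z) / (w - z))%C d) with ((k w - k z) / (w - z) - d)%C.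
    assert (Nz : (w - z)%C <> 0%C).
    { intros E. apply N. replace w with (w - z + z)%C by ring. rewrite E. ring. }
    replace ((k w - k z) / (w - z) - d)%C
      with ((k w - k z - d * (w - z)) / (w - z))%C by (field; auto).
    rewrite Cmod_div by auto. apply Cmod_gt_0 in Nz. pose proof (cond_pos eps).
    apply (Rmult_lt_reg_r (Cmod (w - z))); auto.
    unfold Rdiv at 1. rewrite Rmult_assoc, Rinv_l by lra. nra.
  - apply filter_forall. intros w. change C in w.
    destruct (Ceq_dec w z) as [->|N]; [cring|].
    ceq. field. intros E. apply N. replace w with (w - z + z)%C by ring. rewrite E. ring.
Qed.

Lemma cdiff_cauchy_riemann (k ka : C -> C) (z : C) :
  locally z (fun w => is_derive (fun a => fst (k (a, snd w))) (fst w) (fst (ka w))) ->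
  locally z (fun w => is_derive (fun a => snd (k (a, snd w))) (fst w) (snd (ka w))) ->
  is_derive (fun b => fst (k (fst z, b))) (snd z) (- snd (ka z)) ->
  is_derive (fun b => snd (k (fst z, b))) (snd z) (fst (ka z)) ->
  continuous ka z -> cdiff k z (ka z).
Proof.
  destruct z as [x y]. intros Ux Vx Uy Vy Hc.
  assert (FU := is_derive_filterdiff (fun a b => fst (k (a, b))) x y
    (fun a b => fst (ka (a, b))) (- snd (ka (x, y)))).
  assert (FV := is_derive_filterdiff (fun a b => snd (k (a, b))) x y
    (fun a b => snd (ka (a, b))) (fst (ka (x, y)))).
  assert (ext : forall P Q : C -> Prop, (forall w, P w -> Q w) ->
    locally ((x, y) : C) P -> locally ((x, y) : C) Q) by (intros P Q; apply filter_imp).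
  destruct FU as [_ FU]; [| exact Uy | |].
  { revert Ux. apply ext. now intros [a b]. }
  { apply (continuous_ext (fun w : C => fst (ka w))); [now intros [a b]|].
    now apply continuous_re. }
  destruct FV as [_ FV]; [| exact Vy | |].
  { revert Vx. apply ext. now intros [a b]. }
  { apply (continuous_ext (fun w : C => snd (ka w))); [now intros [a b]|].
    now apply continuous_im. }
  apply cdiff_little_o. intros eps.
  assert (e2 : 0 < eps / 2) by (destruct eps; simpl; lra).
  specialize (FU (x, y) (fun P H => H) (mkposreal _ e2)).
  specialize (FV (x, y) (fun P H => H) (mkposreal _ e2)).
  generalize (filter_and _ _ FU FV); apply (ext _ _).
  intros [a b] [HU HV]. simpl in HU, HV.
  set (w := (a, b) : C). set (z := (x, y) : C).
  assert (T : forall v : C, Cmod v <= Rabs (fst v) + Rabs (snd v)).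
  { intros v. replace v with (RtoC (fst v) + Ci * RtoC (snd v))%C at 1.
    - eapply Rle_trans; [apply Cmod_triangle|].
      rewrite Cmod_mult, Cmod_Ci, !Cmod_R. lra.
    - apply injective_projections; simpl; ring. }
  eapply Rle_trans; [apply T|].
  assert (En : forall p q : R, sqrt (Rabs p * (Rabs p * 1) + Rabs q * (Rabs q * 1))
    = sqrt (p * (p * 1) + q * (q * 1))).
  { intros p q. rewrite !Rmult_1_r. now rewrite <- !(Rsqr_abs _ : Rsqr _ = Rabs _ * Rabs _). }
  match type of HU with _ <= _ * ?n => replace n with (Cmod (w - z)%C) in HU
    by (symmetry; exact (En (a + - x) (b + - y))) end.
  match type of HV with _ <= _ * ?n => replace n with (Cmod (w - z)%C) in HV
    by (symmetry; exact (En (a + - x) (b + - y))) end.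
  apply Rle_trans with (eps / 2 * Cmod (w - z) + eps / 2 * Cmod (w - z)); [|lra].
  apply Rplus_le_compat.
  - eapply Rle_trans; [|exact HU]. right.
    unfold norm, minus, plus, opp, scal, mult; simpl.
    unfold abs, mult; simpl. f_equal. unfold w, z; ring.
  - eapply Rle_trans; [|exact HV]. right.
    unfold norm, minus, plus, opp, scal, mult; simpl.
    unfold abs, mult; simpl. f_equal. unfold w, z; ring.
Qed.

Definition coordinate (c : quat -> R) : Prop :=
  (forall (f : R -> quat) t l, is_derive f t l -> is_derive (fun u => c (f u)) t (c l)) /\
  (forall (f : C -> quat) z, continuous f z -> continuous (fun w => c (f w)) z) /\
  (forall x, c (qopp x) = - c x).

Lemma coordinate_q0 : coordinate q0.
Proof.
  unfold q0; split; [|split]; [intros f t l H|intros f z H|now intros [[[a b] c] d]].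
  - exact (is_derive_fst _ _ _ (is_derive_fst _ _ _ (is_derive_fst _ _ _ H))).
  - exact (continuous_fst_comp _ _ (continuous_fst_comp _ _ (continuous_fst_comp _ _ H))).
Qed.

Lemma coordinate_q1 : coordinate q1.
Proof.
  unfold q1; split; [|split]; [intros f t l H|intros f z H|now intros [[[a b] c] d]].
  - exact (is_derive_snd _ _ _ (is_derive_fst _ _ _ (is_derive_fst _ _ _ H))).
  - exact (continuous_snd_comp _ _ (continuous_fst_comp _ _ (continuous_fst_comp _ _ H))).
Qed.

Lemma coordinate_q2 : coordinate q2.
Proof.
  unfold q2; split; [|split]; [intros f t l H|intros f z H|now intros [[[a b] c] d]].
  - exact (is_derive_snd _ _ _ (is_derive_fst _ _ _ H)).
  - exact (continuous_snd_comp _ _ (continuous_fst_comp _ _ H)).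
Qed.

Lemma coordinate_q3 : coordinate q3.
Proof.
  unfold q3; split; [|split]; [intros f t l H|intros f z H|now intros [[[a b] c] d]].
  - exact (is_derive_snd _ _ _ H).
  - exact (continuous_snd_comp _ _ H).
Qed.

Definition component (c : quat -> R) (F : C -> quatC) (z : C) : C :=
  (c (fst (F z)), c (snd (F z))).

Lemma component_cdiff D F Fa Fb c z :
  open D -> coordinate c ->
  (forall z : C, D z ->
    is_derive (fun a : R => F (a, Im z)) (Re z) (Fa z) /\
    is_derive (fun b : R => F (Re z, b)) (Im z) (Fb z) /\
    continuous Fa z /\ continuous Fb z /\
    qCadd (Fa z) (qCmul qCi (Fb z)) = qC0) ->
  D z ->
  cdiff (component c F) z (component c Fa z) /\ continuous (component c Fa) z.
Proof.
  intros Ho (Cd & Cc & Copp) H Hz.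
  assert (Cont : continuous (component c Fa) z).
  { destruct (H z Hz) as (_ & _ & HFa & _).
    apply continuous_C; unfold component; simpl; apply Cc.
    - now apply continuous_fst_comp.
    - now apply continuous_snd_comp. }
  split; [|exact Cont].
  destruct (H z Hz) as (_ & HFb & _ & _ & CR).
  assert (E1 : fst (Fb z) = qopp (snd (Fa z)) /\ snd (Fb z) = fst (Fa z)).
  { revert CR. generalize (Fa z) (Fb z).
    intros [[[[a0 a1] a2] a3] [[[b0 b1] b2] b3]] [[[[c0 c1] c2] c3] [[[d0 d1] d2] d3]].
    unfold qCadd, qCmul, qCi, qC0; simpl. quat_simpl. intros E.
    injection E as E0 E1 E2 E3 E4 E5 E6 E7.
    split; apply quat_ext; quat_simpl; lra. }
  destruct E1 as [Eb1 Eb2].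
  pose proof (Ho z Hz) as Lz.
  apply cdiff_cauchy_riemann; [| | | |exact Cont].
  - revert Lz; apply filter_imp. intros w Hw. destruct (H w Hw) as (HFa & _).
    exact (Cd _ _ _ (is_derive_fst _ _ _ HFa)).
  - revert Lz; apply filter_imp. intros w Hw. destruct (H w Hw) as (HFa & _).
    exact (Cd _ _ _ (is_derive_snd _ _ _ HFa)).
  - pose proof (Cd _ _ _ (is_derive_fst _ _ _ HFb)) as K.
    rewrite Eb1, Copp in K. exact K.
  - pose proof (Cd _ _ _ (is_derive_snd _ _ _ HFb)) as K.
    rewrite Eb2 in K. exact K.
Qed.

Definition csq (F : C -> quatC) (z : C) : C :=
  (component q0 F z * component q0 F z + component q1 F z * component q1 F z
   + component q2 F z * component q2 F z + component q3 F z * component q3 F z)%C.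

Lemma csq_holo D F :
  open D -> stem_holomorphic D F -> (forall z : C, Cmod z < 1 -> D z) ->
  exists g1, holo 1 (csq F) g1.
Proof.
  intros Ho (Fa & Fb & H) HD.
  assert (K : forall c, coordinate c -> holo 1 (component c F) (component c Fa)).
  { intros c Hc z Hz. now apply (component_cdiff D F Fa Fb c z Ho Hc H), HD. }
  pose proof (K _ coordinate_q0) as K0. pose proof (K _ coordinate_q1) as K1.
  pose proof (K _ coordinate_q2) as K2. pose proof (K _ coordinate_q3) as K3.
  eexists.
  exact (holo_plus _ _ _ _ _ (holo_plus _ _ _ _ _ (holo_plus _ _ _ _ _
    (holo_mult _ _ _ _ _ K0 K0) (holo_mult _ _ _ _ _ K1 K1))
    (holo_mult _ _ _ _ _ K2 K2)) (holo_mult _ _ _ _ _ K3 K3)).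
Qed.

Lemma sym_stem_csq F z :
  sym_stem F z = (qreal (fst (csq F z)), qreal (snd (csq F z))).
Proof.
  unfold sym_stem, csq, component, qCmul, qCc; simpl.
  destruct (F z) as [[[[a0 a1] a2] a3] [[[b0 b1] b2] b3]]; simpl.
  f_equal; quat_ring.
Qed.

Lemma im_sphere_intro I : q0 I = 0 -> q1 I ^ 2 + q2 I ^ 2 + q3 I ^ 2 = 1 -> im_sphere I.
Proof.
  destruct I as [[[a b] c] d]. unfold im_sphere. quat_simpl. intros -> E.
  apply quat_ext; quat_simpl; lra.
Qed.

Lemma im_unit_sphere x : im_sphere (im_unit x).
Proof.
  unfold im_unit. destruct (Req_EM_T (qabs (qim x)) 0) as [E|N].
  - apply im_sphere_intro; quat_simpl; ring.
  - assert (P : qabs (qim x) * qabs (qim x) = q1 x ^ 2 + q2 x ^ 2 + q3 x ^ 2).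
    { unfold qabs. rewrite sqrt_sqrt.
      - quat_simpl. ring.
      - pose proof (pow2_ge_0 (q0 (qim x))); pose proof (pow2_ge_0 (q1 (qim x))).
        pose proof (pow2_ge_0 (q2 (qim x))); pose proof (pow2_ge_0 (q3 (qim x))). lra. }
    revert N P. generalize (qabs (qim x)). intros m N P.
    apply im_sphere_intro.
    + quat_simpl. ring.
    + transitivity ((q1 x ^ 2 + q2 x ^ 2 + q3 x ^ 2) / (m * m)).
      * quat_simpl. field. auto.
      * rewrite <- P. field. auto.
Qed.

Lemma qabs_slice a b I : im_sphere I -> qabs (qslice a I b) = Cmod (a, b).
Proof.
  intros HI. destruct (im_sphere_components I HI) as [I0 I1].
  unfold qabs, Cmod. f_equal. simpl fst; simpl snd.
  transitivity (a ^ 2 + (q1 I ^ 2 + q2 I ^ 2 + q3 I ^ 2) * b ^ 2).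
  - quat_simpl. rewrite I0. ring.
  - rewrite I1. ring.
Qed.

Lemma qabs_symmetrization F x :
  qabs (symmetrization F x) = Cmod (csq F (q0 x, qabs (qim x))).
Proof.
  unfold symmetrization, slice. rewrite sym_stem_csq. simpl fst; simpl snd.
  rewrite (surjective_pairing (csq F _)). apply qabs_slice, im_unit_sphere.
Qed.

Lemma csq_conj D F z : stem D F -> D z -> csq F (Cconj z) = Cconj (csq F z).
Proof.
  intros HF Hz. unfold csq, component. rewrite (HF z Hz).
  destruct (F z) as [[[[a0 a1] a2] a3] [[[b0 b1] b2] b3]].
  unfold qCbar; apply injective_projections; simpl; quat_simpl; ring.
Qed.

Lemma csq_zero_of_slice F z I :
  im_sphere I -> qadd (fst (F z)) (qmul I (snd (F z))) = qreal 0 -> csq F z = 0%C.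
Proof.
  intros HI E. destruct (im_sphere_components I HI) as [I0 I1].
  unfold csq, component.
  destruct (F z) as [[[[a0 a1] a2] a3] [[[b0 b1] b2] b3]].
  destruct I as [[[i0 i1] i2] i3]. simpl in *. quat_simpl. subst i0.
  injection E as E0 E1 E2 E3.
  set (n := b0 ^ 2 + b1 ^ 2 + b2 ^ 2 + b3 ^ 2).
  assert (A0 : a0 = i1 * b1 + i2 * b2 + i3 * b3) by lra.
  assert (A1 : a1 = - (i1 * b0 + i2 * b3 - i3 * b2)) by lra.
  assert (A2 : a2 = - (i2 * b0 + i3 * b1 - i1 * b3)) by lra.
  assert (A3 : a3 = - (i3 * b0 + i1 * b2 - i2 * b1)) by lra.
  clear E0 E1 E2 E3. subst a0 a1 a2 a3.
  apply injective_projections; simpl.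
  - transitivity (n * (i1 ^ 2 + i2 ^ 2 + i3 ^ 2 - 1)); [unfold n; ring|].
    replace (i1 ^ 2 + i2 ^ 2 + i3 ^ 2 - 1) with 0 by (simpl; lra). ring.
  - ring.
Qed.

Lemma slice_zero_of_csq F z :
  csq F z = 0%C ->
  exists I, im_sphere I /\ qadd (fst (F z)) (qmul I (snd (F z))) = qreal 0.
Proof.
  unfold csq, component.
  destruct (F z) as [[[[a0 a1] a2] a3] [[[b0 b1] b2] b3]]; simpl.
  intros E. pose proof (f_equal fst E) as E1. pose proof (f_equal snd E) as E2.
  clear E. quat_simpl.
  set (n := b0 * b0 + b1 * b1 + b2 * b2 + b3 * b3).
  assert (En : a0 * a0 + a1 * a1 + a2 * a2 + a3 * a3 = n) by (unfold n; lra).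
  assert (Ep : a0 * b0 + a1 * b1 + a2 * b2 + a3 * b3 = 0) by lra.
  assert (S : forall x y u v : R, x * x + y * y + u * u + v * v = 0 ->
    x = 0 /\ y = 0 /\ u = 0 /\ v = 0) by (intros; repeat split; nra).
  destruct (Req_dec n 0) as [N|N].
  - exists (mkq 0 1 0 0). split; [apply im_sphere_intro; quat_simpl; ring|].
    destruct (S _ _ _ _ N) as (-> & -> & -> & ->).
    rewrite N in En. destruct (S _ _ _ _ En) as (-> & -> & -> & ->).
    apply quat_ext; quat_simpl; ring.
  - (* [I = - p q^c / |q|^2], where [F z = p + \imath q]. *)
    exists (mkq 0
      ((a0 * b1 - a1 * b0 + a2 * b3 - a3 * b2) / n)
      ((a0 * b2 - a1 * b3 - a2 * b0 + a3 * b1) / n)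
      ((a0 * b3 + a1 * b2 - a2 * b1 - a3 * b0) / n)).
    split.
    + apply im_sphere_intro; quat_simpl; [reflexivity|].
      transitivity (((a0 * a0 + a1 * a1 + a2 * a2 + a3 * a3) * n
        - (a0 * b0 + a1 * b1 + a2 * b2 + a3 * b3) ^ 2) / (n * n)).
      * unfold n. field. exact N.
      * rewrite En, Ep. field. exact N.
    + apply quat_ext; quat_simpl.
      * transitivity (b0 * (a0 * b0 + a1 * b1 + a2 * b2 + a3 * b3) / n);
          [unfold n; field; exact N|rewrite Ep; field; exact N].
      * transitivity (b1 * (a0 * b0 + a1 * b1 + a2 * b2 + a3 * b3) / n);
          [unfold n; field; exact N|rewrite Ep; field; exact N].
      * transitivity (b2 * (a0 * b0 + a1 * b1 + a2 * b2 + a3 * b3) / n);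
          [unfold n; field; exact N|rewrite Ep; field; exact N].
      * transitivity (b3 * (a0 * b0 + a1 * b1 + a2 * b2 + a3 * b3) / n);
          [unfold n; field; exact N|rewrite Ep; field; exact N].
Qed.

Lemma im_sphere_i (e : R) : e * e = 1 -> im_sphere (mkq 0 e 0 0).
Proof. intros E. apply im_sphere_intro; quat_simpl; nra. Qed.

(* Parallelogram identity for the values [p + I q] and [p - I q] with [I = i]. *)
Lemma Cmod_csq_le F z :
  qabs (qadd (fst (F z)) (qmul (mkq 0 1 0 0) (snd (F z)))) < 1 ->
  qabs (qadd (fst (F z)) (qmul (mkq 0 (-1) 0 0) (snd (F z)))) < 1 ->
  Cmod (csq F z) <= 1.
Proof.
  intros H1 H2.
  assert (S : forall x, sqrt x < 1 -> x < 1).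
  { intros x H. destruct (Rlt_le_dec x 1) as [L|L]; auto.
    apply sqrt_le_1_alt in L. rewrite sqrt_1 in L. lra. }
  unfold qabs in H1, H2. apply S in H1. apply S in H2.
  assert (T : Cmod (csq F z) <= Cmod (component q0 F z) ^ 2 + Cmod (component q1 F z) ^ 2
    + Cmod (component q2 F z) ^ 2 + Cmod (component q3 F z) ^ 2).
  { unfold csq. simpl. rewrite !Rmult_1_r, <- !Cmod_mult.
    eapply Rle_trans; [apply Cmod_triangle|]. apply Rplus_le_compat_r.
    eapply Rle_trans; [apply Cmod_triangle|]. apply Rplus_le_compat_r.
    apply Cmod_triangle. }
  rewrite !Cmod_sq in T. eapply Rle_trans; [exact T|]. clear T.
  unfold component.
  destruct (F z) as [[[[a0 a1] a2] a3] [[[b0 b1] b2] b3]]; simpl in *. quat_simpl. nra.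
Qed.

Lemma disc_in_domain D :
  conj_symmetric D -> (forall x : quat, qabs x <= 1 -> Omega D x) ->
  forall z : C, Cmod z < 1 -> D z.
Proof.
  intros Hs HD [a b] Hz.
  destruct (HD (qslice a (mkq 0 1 0 0) b)) as (a' & b' & I & HDz & HI & E).
  { rewrite qabs_slice; [lra|]. apply im_sphere_i; ring. }
  destruct (im_sphere_components I HI) as [I0 I1].
  destruct I as [[[i0 i1] i2] i3]. quat_simpl. subst i0.
  injection E as E0 E1 E2 E3.
  assert (A : a' = a) by lra. subst a'.
  assert (B : (b - b') * (b + b') = 0).
  { assert (Eb : b * b = (i1 * b') * (i1 * b') + (i2 * b') * (i2 * b') + (i3 * b') * (i3 * b')).
    { replace (i1 * b') with b by lra. replace (i2 * b') with 0 by lra.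
      replace (i3 * b') with 0 by lra. ring. }
    replace ((i1 * b') * (i1 * b') + (i2 * b') * (i2 * b') + (i3 * b') * (i3 * b'))
      with ((i1 * (i1 * 1) + i2 * (i2 * 1) + i3 * (i3 * 1)) * (b' * b')) in Eb by ring.
    rewrite I1 in Eb. lra. }
  apply Rmult_integral in B. destruct B as [B|B].
  - replace b with b' by lra. exact HDz.
  - apply Hs in HDz. unfold Cconj in HDz; simpl in HDz.
    now replace b with (- b') by lra.
Qed.

Lemma cone_slice a b I : im_sphere I -> cone (qslice a I b) ->
  b <> 0 /\ fst ((a, b) * (a, b))%C <= 0.
Proof.
  intros HI (a' & b' & J & HJ & E & Hb & Nb).
  destruct (im_sphere_components I HI) as [I0 I1].
  destruct (im_sphere_components J HJ) as [J0 J1].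
  destruct I as [[[i0 i1] i2] i3], J as [[[j0 j1] j2] j3]. quat_simpl. subst i0 j0.
  injection E as E0 E1 E2 E3.
  assert (A : a' = a) by lra. subst a'.
  assert (B : b * b = b' * b').
  { transitivity ((i1 * (i1 * 1) + i2 * (i2 * 1) + i3 * (i3 * 1)) * (b * b)); [rewrite I1; ring|].
    transitivity ((j1 * (j1 * 1) + j2 * (j2 * 1) + j3 * (j3 * 1)) * (b' * b')); [|rewrite J1; ring].
    replace ((i1 * (i1 * 1) + i2 * (i2 * 1) + i3 * (i3 * 1)) * (b * b))
      with ((i1 * b) * (i1 * b) + (i2 * b) * (i2 * b) + (i3 * b) * (i3 * b)) by ring.
    replace (i1 * b) with (j1 * b') by lra. replace (i2 * b) with (j2 * b') by lra.
    replace (i3 * b) with (j3 * b') by lra. ring. }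
  split; [intros ->; nra|].
  pose proof (Rabs_pos a). pose proof (Rsqr_abs a) as Q. unfold Rsqr in Q. nra.
Qed.

Lemma laplacian_symmetrization D F g1 g2 e :
  stem D F -> (forall z : C, Cmod z < 1 -> D z) ->
  0 < e -> holo e (csq F) g1 -> holo e g1 g2 -> csq F (RtoC 0) <> 0%C ->
  laplacian (fun x : quat => ln (qabs (symmetrization F x))) (qreal 0)
    = -2 * log_second (csq F) g1 g2.
Proof.
  intros HF HD He Hg Hg1 G0.
  assert (R1 : Derive_n (fun t => ln (qabs (symmetrization F (qadd (qreal 0) (mkq t 0 0 0))))) 2 0
    = log_second (csq F) g1 g2).
  { transitivity (Derive_n (fun t => ln (Cmod (csq F (RtoC t * RtoC 1)%C))) 2 0).
    - apply Derive_n_ext. intros t. rewrite qabs_symmetrization. do 3 f_equal.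
      apply injective_projections.
      + quat_simpl. ring.
      + unfold qabs. quat_simpl.
        transitivity (sqrt 0); [f_equal; ring|]. rewrite sqrt_0. ring.
    - rewrite (Derive_ln_Cmod_line _ g1 g2 e) by auto.
      unfold log_second. f_equal. ring. }
  assert (R2 : forall v : R -> quat,
    (forall t, q0 (v t) = 0) -> (forall t, qabs (qim (v t)) = Rabs t) ->
    Derive_n (fun t => ln (qabs (symmetrization F (v t)))) 2 0 = - log_second (csq F) g1 g2).
  { intros v V0 V1.
    transitivity (Derive_n (fun t => ln (Cmod (csq F (RtoC t * Ci)%C))) 2 0).
    - apply Derive_n_ext_loc.
      assert (L : locally 0 (fun t => -1 < t < 1)).
      { apply filter_and; [apply (open_gt (-1))|apply (open_lt 1)]; lra. }
      revert L; apply filter_imp. intros t Ht. change R in t.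
      rewrite qabs_symmetrization, V0, V1.
      replace (RtoC t * Ci)%C with ((0, t) : C) by (apply injective_projections; simpl; ring).
      destruct (Rle_dec 0 t) as [P|P].
      + now rewrite Rabs_pos_eq.
      + rewrite Rabs_left by lra.
        replace ((0, - t) : C) with (Cconj (0, t)) by (unfold Cconj; simpl; f_equal; ring).
        rewrite (csq_conj D), Cmod_conj; auto.
        apply HD. replace ((0, t) : C) with (Ci * RtoC t)%C
          by (apply injective_projections; simpl; ring).
        rewrite Cmod_mult, Cmod_Ci, Cmod_R, Rabs_left; lra.
    - rewrite (Derive_ln_Cmod_line _ g1 g2 e) by auto.
      unfold log_second.
      replace (Ci * Ci)%C with (RtoC (-1)) by (apply injective_projections; simpl; ring).
      rewrite fst_scal. ring. }
  unfold laplacian. rewrite R1, !R2; [ring|..]; intros t;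
    try (quat_simpl; ring); unfold qabs; quat_simpl;
    rewrite <- sqrt_Rsqr_abs; f_equal; unfold Rsqr; ring.
Qed.

Theorem corollary3p12 :
  forall (D : C -> Prop) (F : C -> quatC) (f : quat -> quat),
    open D ->
    conj_symmetric D ->
    slice_regular D F f ->
    (forall x : quat, qabs x <= 1 -> Omega D x) ->
    (forall x : quat, qabs x < 1 -> qabs (f x) < 1) ->
    f (qreal 0) <> qreal 0 ->
    (forall x : quat, Omega D x -> f x = qreal 0 -> cone x) ->
    let fs := symmetrization F in
    let L := laplacian (fun x : quat => ln (qabs (fs x))) (qreal 0) in
    qabs (fs (qreal 0)) * exp (1 / 8 * L) <= 1 ->
    forall r : R,
      0 < r ->
      r < sqrt (qabs (fs (qreal 0))) * exp (1 / 16 * L) ->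
      forall x : quat, qabs x < r -> f x <> qreal 0.
Proof.
  intros D F f Ho Hsym (HF & Hhol & Hind) HO Hbound H0 Hcone fs L Hle r Hr0 Hr x Hx fx.
  assert (HD := disc_in_domain D Hsym HO).
  assert (Hi := im_sphere_i 1 ltac:(ring)).
  assert (Hi' := im_sphere_i (-1) ltac:(ring)).
  set (g := csq F).
  destruct (csq_holo D F Ho Hhol HD) as [g1 Hg]. fold g in Hg.
  destruct (holo_deriv 1 g g1 (1 / 2) Hg ltac:(lra)) as [g2 Hg1].
  assert (Bd : forall z, Cmod z < 1 -> Cmod (g z) <= 1).
  { intros [a b] Hz. apply Cmod_csq_le;
      (rewrite <- Hind by (auto; now apply HD)); apply Hbound; now rewrite qabs_slice. }
  assert (Zr : forall a b : R, Cmod (a, b) < 1 -> g (a, b) = 0%C ->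
    b <> 0 /\ fst ((a, b) * (a, b))%C <= 0).
  { intros a b Hz G. destruct (slice_zero_of_csq F _ G) as (I & HI & E).
    assert (Dz : D (a, b)) by now apply HD.
    apply (cone_slice a b I HI), Hcone.
    - now exists a, b, I.
    - now rewrite Hind. }
  assert (G0 : g (RtoC 0) <> 0%C).
  { intros G. destruct (Zr 0 0) as [N _]; auto.
    change (Cmod (RtoC 0) < 1). rewrite Cmod_0; lra. }
  assert (EL : L = -2 * log_second g g1 g2).
  { apply (laplacian_symmetrization D F g1 g2 (1 / 2)); auto; [lra|].
    apply (holo_mono 1); auto; lra. }
  assert (EG : qabs (fs (qreal 0)) = Cmod (g (RtoC 0))).
  { unfold fs. rewrite qabs_symmetrization. unfold g. do 2 f_equal.
    apply injective_projections; [reflexivity|].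
    unfold qabs; quat_simpl. transitivity (sqrt 0); [f_equal; ring|apply sqrt_0]. }
  rewrite EG in *. set (G := Cmod (g (RtoC 0))) in *.
  assert (PG : 0 < G) by now apply Cmod_gt_0.
  assert (r2 : r * r < G * exp (1 / 8 * L)).
  { replace (G * exp (1 / 8 * L)) with
      ((sqrt G * exp (1 / 16 * L)) * (sqrt G * exp (1 / 16 * L))).
    - apply Rmult_le_0_lt_compat; lra.
    - transitivity ((sqrt G * sqrt G) * (exp (1 / 16 * L) * exp (1 / 16 * L))); [ring|].
      rewrite sqrt_sqrt, <- exp_plus by lra. do 2 f_equal. field. }
  assert (r1 : r < 1) by nra.
  destruct (HO x ltac:(lra)) as (a & b & I & Dz & HI & ->).
  rewrite qabs_slice in Hx by auto.
  rewrite Hind in fx by auto.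
  pose proof (csq_zero_of_slice F _ I HI fx) as Gz. fold g in Gz.
  destruct (Zr a b ltac:(lra) Gz) as [Nb _].
  assert (J : ln G - / 4 * log_second g g1 g2 <= 2 * ln (Cmod (a, b))).
  { apply (log_two_zeros g g1 g2 (1 / 2)); auto; try lra.
    - intros [a' b'] Hz Gz'. now apply Zr.
    - unfold g. rewrite (csq_conj D) by auto. fold g. rewrite Gz.
      apply injective_projections; simpl; ring.
    - intros E. apply (f_equal snd) in E. simpl in E. lra. }
  assert (Pz : 0 < Cmod (a, b)).
  { apply Cmod_gt_0. intros E. apply (f_equal snd) in E. now apply Nb. }
  assert (K : ln (G * exp (1 / 8 * L)) < ln (G * exp (1 / 8 * L))); [|lra].
  apply Rle_lt_trans with (ln (Cmod (a, b) * Cmod (a, b))).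
  - rewrite !ln_mult, ln_exp by (auto; apply exp_pos). lra.
  - apply ln_increasing; [nra|]. apply Rle_lt_trans with (r * r); [|exact r2].
    apply Rmult_le_compat; lra.
Qed.
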